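(* Let $(M_i,g_i)$, $i=1,2$, be Riemannian manifolds with $m_i=\dim M_i$, equip $M_1\times M_2$ with the metric $h_{f_1f_2}$, and let $\varphi_i:M_i\to\mathbb R$, $i=1,2$, be smooth functions. Then the Laplacians (with respect to $h_{f_1f_2}$) of the horizontal lift $\varphi_1^h=\varphi_1\circ\pi_1$ and of the vertical lift $\varphi_2^v=\varphi_2\circ\pi_2$ are given by $$\Delta(\varphi_1^h)=\Delta(\varphi_1)^h+\frac{m_2(\mathrm{grad} f_1(\varphi_1))^h}{f_1^h(1+(cf_2^v)^2b_1^h)}-\frac{(cf_2^v)^2}{1+(cf_2^v)^2b_1^h}\Big\{(\mathrm{grad} f_1(\varphi_1))^h\Delta(f_1)^h+H^{\varphi_1}(\mathrm{grad} f_1,\mathrm{grad} f_1)^h-\frac{(cf_2^v)^2(\mathrm{grad} f_1(\varphi_1))^h}{1+(cf_2^v)^2b_1^h}H^{f_1}(\mathrm{grad} f_1,\mathrm{grad} f_1)^h\Big\},$$ $$\Delta(\varphi_2^v)=\frac{1}{(f_1^h)^2}\Big\{\Delta(\varphi_2)^v+\frac{c^2f_2^vb_1^h(\mathrm{grad} f_2(\varphi_2))^v}{1+(cf_2^v)^2b_1^h}\Big\},$$ where $b_1=\|\mathrm{grad} f_1\|^2$.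
   Context: $\pi_i:M_1\times M_2\to M_i$ are the projections; $\varphi_1^h=\varphi_1\circ\pi_1$ and $\varphi_2^v=\varphi_2\circ\pi_2$. $c$ is an arbitrary real number, $f_i:M_i\to(0,\infty)$ is smooth, and $$h_{f_1f_2}=\pi_1^*g_1+(f_1^h)^2\pi_2^*g_2+\frac{c^2}{2}(f_2^v)^2\,df_1^h\odot df_1^h,\qquad \alpha\odot\beta=\alpha\otimes\beta+\beta\otimes\alpha$$ (so the last term is $c^2(f_2^v)^2df_1^h\otimes df_1^h$); it is a Riemannian metric on $M_1\times M_2$. On $M_i$, the gradient, norm, Laplacian $\Delta$ and Hessian $H^{\varphi}$ of a function are taken with respect to $g_i$; $\mathrm{grad} f_i(\varphi_i)$ is the derivative of $\varphi_i$ along $\mathrm{grad} f_i$. The convention is $\Delta\varphi=\mathrm{trace}(\nabla\,\mathrm{grad}\,\varphi)$. *)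

(* Defs.v *)
From HB Require Import structures.
From mathcomp Require Import all_boot all_order all_algebra.
From mathcomp Require Import all_classical all_reals all_analysis.
Set Implicit Arguments.
Unset Strict Implicit.
Unset Printing Implicit Defensive.
Import Order.TTheory GRing.Theory Num.Theory.
Import numFieldNormedType.Exports.
Local Open Scope classical_set_scope.
Local Open Scope ring_scope.

Section EuclideanSmoothness.
Context {R : realType} {n : nat}.
Implicit Types (f : 'rV[R]_n -> R) (x : 'rV[R]_n).

Definition partial (i : 'I_n) f : 'rV[R]_n -> R :=
  fun x => 'D_(delta_mx 0 i) f x.

(* C^oo on a neighbourhood of x: every iterated partial derivative (f itself
   included, for s = [::]) is Frechet differentiable there. *)
Definition smooth_near f x : Prop :=
  \forall y \near x, forall s : seq 'I_n, differentiable (foldr partial f s) y.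

End EuclideanSmoothness.

(* [cmap] and [cinv] are total functions; only [cmap] on [dom] and [cinv] on
   the image [cmap @` dom] are meaningful. *)
Record chart (R : realType) (M : topologicalType) (n : nat) := Chart {
  dom : set M;
  cmap : M -> 'rV[R]_n;
  cinv : 'rV[R]_n -> M }.

Record is_chart (R : realType) (M : topologicalType) (n : nat)
    (u : chart R M n) : Prop := {
  chart_open_dom : open (dom u);
  chart_open_img : open (cmap u @` dom u);
  chart_cancel : forall p, dom u p -> cinv u (cmap u p) = p;
  chart_cont : forall p, dom u p -> {for p, continuous (cmap u)};
  chart_inv_cont :
    forall x, (cmap u @` dom u) x -> {for x, continuous (cinv u)} }.

Definition compatible (R : realType) (M : topologicalType) (n : nat)
    (u v : chart R M n) : Prop :=
  forall p, dom u p -> dom v p ->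
  forall i, smooth_near (fun x => cmap v (cinv u x) 0 i) (cmap u p).

Record smooth_manifold (R : realType) (M : topologicalType) (n : nat)
    (A : set (chart R M n)) : Prop := {
  manifold_hausdorff : hausdorff_space M;
  manifold_second_countable : @second_countable M;
  manifold_chart : forall u, A u -> is_chart u;
  manifold_cover : forall p, exists2 u, A u & dom u p;
  manifold_compatible : forall u v, A u -> A v -> compatible u v }.

Section ProductAtlas.
Context {R : realType} {M1 M2 : topologicalType} {n1 n2 : nat}.

Definition prod_chart (u1 : chart R M1 n1) (u2 : chart R M2 n2) :
    chart R (M1 * M2)%type (n1 + n2) :=
  Chart (dom u1 `*` dom u2)
    (fun p => row_mx (cmap u1 p.1) (cmap u2 p.2))
    (fun x => (cinv u1 (lsubmx x), cinv u2 (rsubmx x))).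

Definition prod_atlas (A1 : set (chart R M1 n1)) (A2 : set (chart R M2 n2)) :
    set (chart R (M1 * M2)%type (n1 + n2)) :=
  [set w | exists u1 u2, [/\ A1 u1, A2 u2 & w = prod_chart u1 u2]].

End ProductAtlas.

(* Tangent vectors are operators on real functions; a covariant 2-tensor field
   and a connection are therefore total functions of such operators, whose
   values matter only on tangent vectors. *)
Notation tvec R M := ((M -> R) -> R) (only parsing).
Notation vfield R M := (M -> tvec R M) (only parsing).
Notation oneform R M := (M -> tvec R M -> R) (only parsing).
Notation tensor2 R M := (M -> tvec R M -> tvec R M -> R) (only parsing).
Notation connection R M :=
  (M -> tvec R M -> vfield R M -> tvec R M) (only parsing).

Section Tangent.
Context {R : realType} {M : topologicalType} {n : nat}.
Variable A : set (chart R M n).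
Implicit Types (p q : M) (phi psi : M -> R) (X Y : tvec R M) (Z : vfield R M).

(* smoothness near p, not merely at p *)
Definition smooth_at p phi : Prop :=
  forall u, A u -> dom u p -> smooth_near (phi \o cinv u) (cmap u p).

Definition smooth phi : Prop := forall p, smooth_at p phi.

(* The derivation at p attached to the coordinate vector a in the chart u.
   It acts on functions smooth near p and is set to 0 on all others, so that
   tangent vectors are equal as soon as they agree on functions smooth near
   p. *)
Definition chart_tvec (u : chart R M n) p (a : 'rV[R]_n) : tvec R M :=
  fun phi => if `[< smooth_at p phi >]
             then 'D_a (phi \o cinv u) (cmap u p) else 0.

Definition tangent p X : Prop :=
  exists u a, [/\ A u, dom u p & X = chart_tvec u p a].

(* Z is a smooth vector field on a neighbourhood of p *)
Definition smooth_field_at p Z : Prop :=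
  (\forall q \near p, tangent q (Z q)) /\
  forall phi, smooth_at p phi -> smooth_at p (fun q => Z q phi).

Definition tangent_frame p (e : 'I_n -> tvec R M) : Prop :=
  (forall i, tangent p (e i)) /\
  forall X, tangent p X ->
    exists! a : 'rV[R]_n, X = fun phi => \sum_i a 0 i * e i phi.

(* the trace of the matrix of L : T_pM -> T_pM in any basis of T_pM *)
Definition tangent_trace p (L : tvec R M -> tvec R M) : R :=
  xget 0 [set t | exists (e : 'I_n -> tvec R M) (a : 'M[R]_n),
    [/\ tangent_frame p e,
        forall j, L (e j) = fun phi => \sum_i a i j * e i phi
      & t = \tr a]].

End Tangent.

Section Tensors.
Context {R : realType} {M : topologicalType}.

Definition differential (phi : M -> R) : oneform R M := fun _ X => X phi.

Definition odot (alpha beta : oneform R M) : tensor2 R M :=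
  fun p X Y => alpha p X * beta p Y + beta p X * alpha p Y.

Context {N : topologicalType} {k : nat}.
Variable B : set (chart R N k).

Definition pushforward (F : M -> N) (p : M) (X : tvec R M) : tvec R N :=
  fun phi => if `[< smooth_at B (F p) phi >] then X (phi \o F) else 0.

Definition pullback (F : M -> N) (g : tensor2 R N) : tensor2 R M :=
  fun p X Y => g (F p) (pushforward F p X) (pushforward F p Y).

End Tensors.

Section Riemannian.
Context {R : realType} {M : topologicalType} {n : nat}.
Variable A : set (chart R M n).

Record riemannian_metric (g : tensor2 R M) : Prop := {
  metric_sym : forall p X Y, tangent A p X -> tangent A p Y ->
    g p X Y = g p Y X;
  metric_linear : forall p (a : R) X Y Z,
    tangent A p X -> tangent A p Y -> tangent A p Z ->
    g p (fun phi => a * X phi + Y phi) Z = a * g p X Z + g p Y Z;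
  metric_pos : forall p X, tangent A p X -> X <> (fun=> 0) -> 0 < g p X X;
  metric_smooth : forall p X Y,
    smooth_field_at A p X -> smooth_field_at A p Y ->
    smooth_at A p (fun q => g q (X q) (Y q)) }.

(* [nabla p X Z] is the covariant derivative at p, in the direction X of T_pM,
   of a vector field Z which is smooth near p. *)
Record levi_civita (g : tensor2 R M) (nabla : connection R M) : Prop := {
  lc_tangent : forall p X Z, tangent A p X -> smooth_field_at A p Z ->
    tangent A p (nabla p X Z);
  lc_smooth : forall p Y Z, smooth_field_at A p Y -> smooth_field_at A p Z ->
    smooth_field_at A p (fun q => nabla q (Y q) Z);
  lc_linear : forall p (a : R) X Y Z,
    tangent A p X -> tangent A p Y -> smooth_field_at A p Z ->
    nabla p (fun phi => a * X phi + Y phi) Z =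
    (fun phi => a * nabla p X Z phi + nabla p Y Z phi);
  lc_additive : forall p X Y Z,
    tangent A p X -> smooth_field_at A p Y -> smooth_field_at A p Z ->
    nabla p X (fun q phi => Y q phi + Z q phi) =
    (fun phi => nabla p X Y phi + nabla p X Z phi);
  lc_leibniz : forall p X (phi : M -> R) Z,
    tangent A p X -> smooth_at A p phi -> smooth_field_at A p Z ->
    nabla p X (fun q psi => phi q * Z q psi) =
    (fun psi => X phi * Z p psi + phi p * nabla p X Z psi);
  lc_torsion_free : forall p Y Z phi,
    smooth_field_at A p Y -> smooth_field_at A p Z -> smooth_at A p phi ->
    nabla p (Y p) Z phi - nabla p (Z p) Y phi =
    Y p (fun q => Z q phi) - Z p (fun q => Y q phi);
  lc_metric : forall p X Y Z,
    tangent A p X -> smooth_field_at A p Y -> smooth_field_at A p Z ->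
    X (fun q => g q (Y q) (Z q)) =
    g p (nabla p X Y) (Z p) + g p (Y p) (nabla p X Z) }.

Definition levi_civita_connection (g : tensor2 R M) : connection R M :=
  xget (fun _ _ _ _ => 0) [set nabla | levi_civita g nabla].

Definition norm (g : tensor2 R M) (p : M) (X : tvec R M) : R :=
  Num.sqrt (g p X X).

(* [grad g phi p psi] is the derivative of psi at p along grad phi *)
Definition grad (g : tensor2 R M) (phi : M -> R) : vfield R M := fun p =>
  xget (fun=> 0) [set X | tangent A p X /\
    forall Y, tangent A p Y -> g p X Y = differential phi p Y].

Definition hessian (g : tensor2 R M) (phi : M -> R) : tensor2 R M :=
  fun p X Y => g p (levi_civita_connection g p X (grad g phi)) Y.

Definition laplacian (g : tensor2 R M) (phi : M -> R) : M -> R := fun p =>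
  tangent_trace A p (fun X => levi_civita_connection g p X (grad g phi)).

End Riemannian.

Section GeneralizedWarpedProduct.
Context {R : realType} {M1 M2 : topologicalType} {n1 n2 : nat}.
Variables (A1 : set (chart R M1 n1)) (A2 : set (chart R M2 n2)).

Definition hlift (phi1 : M1 -> R) : M1 * M2 -> R := phi1 \o fst.
Definition vlift (phi2 : M2 -> R) : M1 * M2 -> R := phi2 \o snd.

Definition warped_metric (c : R) (f1 : M1 -> R) (f2 : M2 -> R)
    (g1 : tensor2 R M1) (g2 : tensor2 R M2) : tensor2 R (M1 * M2)%type :=
  fun p X Y =>
    pullback A1 fst g1 p X Y
    + (hlift f1 p) ^+ 2 * pullback A2 snd g2 p X Y
    + c ^+ 2 / 2 * (vlift f2 p) ^+ 2
      * odot (differential (hlift f1)) (differential (hlift f1)) p X Y.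

End GeneralizedWarpedProduct.

(* Main.v *)
(* In local coordinates, with Gram matrix G, a smooth vector field Z satisfies
   tr (nabla Z) = sum_i d_i Z^i + tr (G^-1 Z(G)) / 2.  In product coordinates
   h_{f1 f2} is block diagonal with blocks H = G1 + s F^T F and f1^2 G2, where
   s = (c f2)^2 and F is the row of partial derivatives of f1.  With W the
   coordinate row of grad f1, the Sherman-Morrison formula
   H^-1 = G1^-1 - s / (1 + s b1) W^T W gives
   grad (phi1^h) = grad phi1 - s (grad f1)(phi1) / (1 + s b1) grad f1,
   grad (phi2^v) = grad phi2 / f1^2,  and
   tr (H^-1 X(H)) = tr (G1^-1 X(G1)) + X(s b1) / (1 + s b1)
   (with X(G1) = 0 and X(b1) = 0 for vertical X).
   Both formulas then follow from the divergence formula and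
   H^phi(grad f, grad f) = (grad f)((grad f)(phi)) - (grad phi)(|grad f|^2) / 2.
   As [levi_civita_connection] is a choice with default 0, the argument also
   needs the existence of the connection: it is defined in a chart by Christoffel
   symbols, and Koszul's formula shows that the chart does not matter. *)

Require Import Defs.
From HB Require Import structures.
From mathcomp Require Import all_boot all_order all_algebra.
From mathcomp Require Import all_classical all_reals all_analysis.
From mathcomp Require Import ring lra.
Import Order.TTheory GRing.Theory Num.Theory.
Import numFieldNormedType.Exports.
Set Implicit Arguments.
Unset Strict Implicit.
Unset Printing Implicit Defensive.
Local Open Scope classical_set_scope.
Local Open Scope ring_scope.

(** * Smooth functions on open sets of R^n *)

(** [grad], [tangent_trace] and [levi_civita_connection] are choices with default values, so each
    must first be shown to be attained and then be computed in a chart. Coordinate formulas hold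
    only near a point of the chart domain. They may still be differentiated, because tangent vectors
    depend on germs alone ([tangent_near]), and they give equalities of operators, because tangent
    vectors vanish on functions that are not smooth. The divergence formula is preferred to
    Christoffel symbols of the warped metric: all that enters is the trace of an inverse Gram matrix
    times a first derivative of the Gram matrix, which splits over the two blocks and responds
    simply to a rank-one update. Hessians enter only at the end, as combinations of first
    derivatives of (grad f1)(phi1) and of b1. *)

Lemma near_open (T : topologicalType) (x : T) (P : set T) :
  (\forall y \near x, P y) -> exists U, [/\ open U, U x & U `<=` P].
Proof.
by move=> nP; exists (interior P); split;
  [exact: open_interior|exact: nP|exact: interior_subset].
Qed.

Section Calculus.
Context {R : realType}.

(** The difference [g - f] vanishes near [x], so its differential there is 0, and [g] is the sum of
    this difference and [f]. *)
Lemma near_eq_differentiable (V W : normedModType R) (f g : V -> W) (x : V) :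
  (\forall y \near x, f y = g y) -> differentiable f x -> differentiable g x.
Proof.
move=> fg df.
suff dh : differentiable (g - f) x.
  by rewrite -(subrK f g); apply: differentiableD.
pose h := g - f.
have e0 : h \o shift x = cst (h x) + \0 +o_ 0 id.
  apply/eqaddoP => _ /posnumP[e].
  have hx : \forall y \near (0 : V), h (y + x) = 0.
    move/nbhs0P : fg; apply: filterS => y fgy.
    by rewrite addrC /h -[LHS]/(g (x + y) - f (x + y)) fgy subrr.
  have h0 : h x = 0 by have := nbhs_singleton hx; rewrite add0r.
  near=> y.
  have hy : h (y + x) = 0 by near: y.
  have -> : (h \o shift x - (cst (h x) + \0)) y = h (y + x) - (h x + 0) by [].
  by rewrite hy h0 addr0 subrr normr0 mulr_ge0.
have c0 : continuous (0 : V -> W) by move=> y; exact: cvg_cst.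
have d0 : 'd h x = (0 : V -> W) :> (V -> W) by exact/diff_unique.
by apply/diff_locallyP; rewrite d0.
Unshelve. all: by end_near. Qed.

Lemma differentiable_row (V : normedModType R) m (G : V -> 'rV[R]_m) (t : V) :
  (forall j, differentiable (fun x => G x 0 j) t) -> differentiable G t.
Proof.
move=> dG.
have -> : G = \sum_j (fun x => G x 0 j *: (delta_mx 0 j : 'rV[R]_m)).
  by rewrite funeqE => x; rewrite fct_sumE -row_sum_delta.
by apply: differentiable_sum => j; exact: differentiableZl.
Qed.

Lemma derive_row_sum m (f : 'rV[R]_m -> R) (y v : 'rV[R]_m) :
  differentiable f y -> 'D_v f y = \sum_j v 0 j * partial j f y.
Proof.
move=> df; rewrite deriveE// {1}[v]row_sum_delta linear_sum/=.
by apply: eq_bigr => j _; rewrite linearZ/= /partial deriveE.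
Qed.

Lemma derive_comp_row (V : normedModType R) m (G : V -> 'rV[R]_m)
    (f : 'rV[R]_m -> R) (t v : V) :
  (forall j, differentiable (fun x => G x 0 j) t) ->
  differentiable f (G t) ->
  'D_v (f \o G) t = \sum_j 'D_v (fun x => G x 0 j) t * partial j f (G t).
Proof.
move=> dG df; have dGt := differentiable_row dG.
have dfG : differentiable (f \o G) t by exact: differentiable_comp.
rewrite deriveE// diff_comp//= -deriveE// derive_row_sum//.
apply: eq_bigr => j _; congr (_ * _).
rewrite -deriveE// derive_mx; first by rewrite mxE.
exact: diff_derivable.
Qed.

(** Restricts [f] to a line, so that the one-variable mean value theorem applies. *)
Lemma is_derive_line (V : normedModType R) (f : V -> R) (a v : V) (s : R) :
  differentiable f (a + s *: v) ->
  is_derive s 1 (fun r => f (a + r *: v)) ('D_v f (a + s *: v)).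
Proof.
move=> df.
have dl : is_diff s (fun r : R => a + r *: v) (fun r : R => r *: v).
  have := @is_diffD _ _ _ (cst a) (fun r : R => r *: v) 0 (fun r : R => r *: v) s.
  rewrite add0r; apply.
apply: DeriveDef.
  by apply: diff_derivable; apply: (@differentiable_comp _ _ _ _ (fun r : R => a + r *: v) f).
rewrite deriveE; last by apply: (@differentiable_comp _ _ _ _ (fun r : R => a + r *: v) f).
rewrite (@diff_comp _ _ _ _ (fun r : R => a + r *: v) f)//= diff_val.
by rewrite scale1r deriveE.
Qed.

(** * Symmetry of second derivatives *)

Section Schwarz.
Context {V : normedModType R}.
Variables (f : V -> R) (x : V).

Let second_difference v w (t : R) : R :=
  f (x + t *: v + t *: w) - f (x + t *: v) - f (x + t *: w) + f x.

(** Two applications of the mean value theorem, along [v] and then along [w], turn the second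
    difference into [t ^+ 2] times the mixed derivative at some point of the parallelogram;
    continuity of that derivative at [x] gives the bound. *)
Let second_difference_cvg (v w : V) :
  (\forall y \near x, differentiable f y) ->
  (\forall y \near x, differentiable ('D_v f) y) ->
  {for x, continuous ('D_w ('D_v f))} ->
  forall e, 0 < e -> exists2 d, 0 < d & forall t, 0 < t < d ->
    `|'D_w ('D_v f) x * t ^+ 2 - second_difference v w t| <= e * t ^+ 2.
Proof.
move=> df ddf cf e e0.
move/cvgrPdist_le : cf => /(_ e e0) cf.
have /nbhs_ballP[r /= r0 rP] : \forall y \near x,
    [/\ differentiable f y, differentiable ('D_v f) y
      & `|'D_w ('D_v f) x - 'D_w ('D_v f) y| <= e].
  by near=> y; split; near: y.
have n0 : 0 < `|v| + `|w| + 1 by rewrite ltr_pwDr// addr_ge0.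
have inball s t d : 0 <= s <= d -> 0 <= t <= d -> d < r / (`|v| + `|w| + 1) ->
    ball x r (x + s *: v + t *: w).
  move=> /andP[s0 sd] /andP[t0 td]; rewrite ltr_pdivlMr// => dr.
  rewrite -ball_normE /ball_/= -addrA opprD addNKr normrN.
  apply: le_lt_trans dr; rewrite (le_trans (ler_normD _ _))// !normrZ.
  rewrite !ger0_norm// !mulrDr mulr1 -[leLHS]addr0 lerD//.
    by rewrite lerD// ler_wpM2r.
  exact: le_trans sd.
(* Below this bound the whole parallelogram on [t *: v] and [t *: w] stays in the ball of radius
   [r]; the added 1 keeps the denominator positive when both vectors vanish. *)
exists (r / (`|v| + `|w| + 1)); first by rewrite divr_gt0.
move=> t /andP[t0 td].
have inb s s' : s \in `[0, t]%R -> s' \in `[0, t]%R ->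
  ball x r (x + s *: v + s' *: w) by rewrite !in_itv/= => ? ?; exact: inball td.
have zt : 0 \in `[0, t]%R by rewrite in_itv/= lexx ltW.
have tt : t \in `[0, t]%R by rewrite in_itv/= lexx ltW.
(* The increment of [f] in direction [t *: w], moved along [v]: the increment of [phi] over [0, t]
   is the second difference. *)
pose phi s := f (x + t *: w + s *: v) - f (x + s *: v).
have dphi s : s \in `[0, t]%R -> is_derive s 1 phi
    ('D_v f (x + t *: w + s *: v) - 'D_v f (x + s *: v)).
  move=> st; apply: is_deriveB; apply: is_derive_line.
    by rewrite addrAC; have [] := rP _ (inb _ _ st tt).
  by have [] := rP _ (inb _ _ st zt); rewrite scale0r addr0.
have sub01 s : s \in `]0, t[%R -> s \in `[0, t]%R.
  by rewrite !in_itv/= => /andP[/ltW-> /ltW->].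
have [|s0 s0t phiE] := @MVT R phi
    (fun s => 'D_v f (x + t *: w + s *: v) - 'D_v f (x + s *: v)) 0 t t0
    (fun s st => dphi s (sub01 s st)).
  apply: derivable_within_continuous => s st.
  by have [] := dphi s st.
have {}s0t := sub01 _ s0t.
(* At the intermediate point [s0] what remains is an increment of ['D_v f] along [w]. *)
pose psi s := 'D_v f (x + s0 *: v + s *: w).
have dpsi s : s \in `[0, t]%R -> is_derive s 1 psi
    ('D_w ('D_v f) (x + s0 *: v + s *: w)).
  by move=> st; apply: is_derive_line; have [] := rP _ (inb _ _ s0t st).
have [|t2 t2t psiE] := @MVT R psi
    (fun s => 'D_w ('D_v f) (x + s0 *: v + s *: w)) 0 t t0
    (fun s st => dpsi s (sub01 s st)).
  apply: derivable_within_continuous => s st.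
  by have [] := dpsi s st.
have {}t2t := sub01 _ t2t.
have -> : second_difference v w t = 'D_w ('D_v f) (x + s0 *: v + t2 *: w) * t ^+ 2.
  transitivity (phi t - phi 0).
    rewrite /phi /second_difference scale0r !addr0 -(addrAC x (t *: v)).
    by ring.
  rewrite phiE -(addrAC x).
  have -> : 'D_v f (x + s0 *: v + t *: w) - 'D_v f (x + s0 *: v) = psi t - psi 0.
    by rewrite /psi scale0r addr0.
  by rewrite psiE; ring.
rewrite -mulrBl normrM (ger0_norm (sqr_ge0 _)) ler_wpM2r ?sqr_ge0//.
by have [] := rP _ (inb _ _ s0t t2t).
Unshelve. all: by end_near. Qed.

(** The second difference is symmetric in [v] and [w], so for small [t] both mixed derivatives,
    multiplied by [t ^+ 2], lie within [e / 2 * t ^+ 2] of the same number. *)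
Lemma derive_commute (v w : V) :
  (\forall y \near x, differentiable f y) ->
  (\forall y \near x, differentiable ('D_v f) y) ->
  (\forall y \near x, differentiable ('D_w f) y) ->
  {for x, continuous ('D_w ('D_v f))} ->
  {for x, continuous ('D_v ('D_w f))} ->
  'D_w ('D_v f) x = 'D_v ('D_w f) x.
Proof.
move=> df dv dw cv cw; apply/eqP; rewrite -subr_eq0 -normr_le0.
apply/ler_addgt0Pr => e e0; rewrite add0r.
have e2 : 0 < e / 2 by rewrite divr_gt0.
have [d1 d10 H1] := second_difference_cvg df dv cv e2.
have [d2 d20 H2] := second_difference_cvg df dw cw e2.
pose t := Num.min d1 d2 / 2.
have m0 : 0 < Num.min d1 d2 by rewrite lt_min d10.
have t0 : 0 < t by rewrite divr_gt0.
have : t < Num.min d1 d2 by rewrite /t ltr_pdivrMr// ltr_pMr// ltr1n.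
rewrite lt_min => /andP[td1 td2].
have {}H1 := H1 t; rewrite t0 td1 in H1; have {H1} := H1 isT.
have {}H2 := H2 t; rewrite t0 td2 in H2; have {H2} := H2 isT.
have -> : second_difference w v t = second_difference v w t.
  by rewrite /second_difference (addrAC x (t *: w)); ring.
move: ('D_w ('D_v f) x) ('D_v ('D_w f) x) (second_difference v w t) => p q s.
move=> h2 h1.
have t20 : 0 < t ^+ 2 by rewrite exprn_gt0.
rewrite -(ler_pM2r t20) -(ger0_norm (ltW t20)) -normrM (ger0_norm (ltW t20)).
have -> : (p - q) * t ^+ 2 = (p * t ^+ 2 - s) - (q * t ^+ 2 - s) by ring.
rewrite (le_trans (ler_normB _ _))//.
by rewrite [e]splitr mulrDl lerD.
Qed.

End Schwarz.

End Calculus.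

Section SmoothFunctions.
Context {R : realType} {n : nat}.
Implicit Types (U : set 'rV[R]_n) (f g : 'rV[R]_n -> R) (x : 'rV[R]_n).

(* The open set U is fixed so that it does not shrink as the order k grows. *)
Fixpoint Ck U k f : Prop :=
  (forall y, U y -> differentiable f y) /\
  (if k is k'.+1 then forall i, Ck U k' (partial i f) else True).

Lemma Ck_differentiable U k f y : Ck U k f -> U y -> differentiable f y.
Proof. by case: k => [|k] [+ _]; apply. Qed.

Lemma CkS U k f : Ck U k.+1 f -> Ck U k f.
Proof.
elim: k f => [|k IH] f [df pf]; split=> // i.
exact: IH.
Qed.

Lemma Ck_sub U V k f : V `<=` U -> Ck U k f -> Ck V k f.
Proof.
move=> VU; elim: k f => [|k IH] f [df pf]; split=> //.
- by move=> y /VU/df.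
- by move=> y /VU/df.
- by move=> i; apply: IH; exact: pf.
Qed.

Lemma partial_ext U i f g : open U -> (forall y, U y -> f y = g y) ->
  forall y, U y -> partial i f y = partial i g y.
Proof.
move=> oU fg y Uy; apply: near_eq_derive.
by apply: filterS (open_nbhs_nbhs (conj oU Uy)) => z; exact: fg.
Qed.

(** On an open set, agreement on the set is agreement near each of its points, so it passes to
    partial derivatives of every order. *)
Lemma Ck_ext U k f g : open U -> (forall y, U y -> f y = g y) ->
  Ck U k f -> Ck U k g.
Proof.
move=> oU; elim: k f g => [|k IH] f g fg [df pf].
  split=> // y Uy; apply: (near_eq_differentiable _ (df _ Uy)).
  by apply: filterS (open_nbhs_nbhs (conj oU Uy)) => z; exact: fg.
split=> [y Uy|i].
  apply: (near_eq_differentiable _ (df _ Uy)).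
  by apply: filterS (open_nbhs_nbhs (conj oU Uy)) => z; exact: fg.
by apply: IH (pf i); exact: partial_ext.
Qed.

Lemma Ck_cst U k (a : R) : Ck U k (cst a).
Proof.
elim: k a => [|k IH] a; split=> //.
move=> i; rewrite (_ : partial i (cst a) = cst 0)// funeqE => y.
by rewrite /partial derive_cst.
Qed.

Lemma CkD U k f g : open U -> Ck U k f -> Ck U k g -> Ck U k (f + g).
Proof.
move=> oU; elim: k f g => [|k IH] f g [df pf] [dg pg]; split=> //.
- by move=> y Uy; apply: differentiableD; [exact: df|exact: dg].
- by move=> y Uy; apply: differentiableD; [exact: df|exact: dg].
move=> i; apply: Ck_ext oU _ (IH _ _ (pf i) (pg i)) => y Uy.
by rewrite /partial deriveD//; apply: diff_derivable; [exact: df|exact: dg].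
Qed.

Lemma CkM U k f g : open U -> Ck U k f -> Ck U k g -> Ck U k (f * g).
Proof.
move=> oU; elim: k f g => [|k IH] f g cf cg.
  by split=> // y Uy; apply: differentiableM;
    [exact: Ck_differentiable cf Uy|exact: Ck_differentiable cg Uy].
split=> [y Uy|i].
  by apply: differentiableM;
    [exact: Ck_differentiable cf Uy|exact: Ck_differentiable cg Uy].
have cfg : Ck U k (f * partial i g + g * partial i f).
  apply: CkD => //; apply: IH; try exact: CkS.
    by case: cg => _; apply.
  by case: cf => _; apply.
apply: Ck_ext oU _ cfg => y Uy.
rewrite /partial deriveM//; apply: diff_derivable.
  exact: Ck_differentiable cf Uy.
exact: Ck_differentiable cg Uy.
Qed.

Lemma Ck_sum U k (I : Type) (r : seq I) (P : pred I) (F : I -> 'rV[R]_n -> R) :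
  open U -> (forall i, P i -> Ck U k (F i)) ->
  Ck U k (fun x => \sum_(i <- r | P i) F i x).
Proof.
move=> oU cF; rewrite (_ : (fun _ => _) = \sum_(i <- r | P i) F i).
  elim/big_ind : _ => //; first exact: (Ck_cst U k 0).
  by move=> f g; exact: CkD.
by rewrite funeqE => x; rewrite fct_sumE.
Qed.

(** The induction closes because a partial derivative of the inverse is [- partial i f] times the
    square of the inverse, which is of class k by the induction hypothesis. *)
Lemma CkV U k f : open U -> (forall y, U y -> f y != 0) -> Ck U k f ->
  Ck U k (fun y => (f y)^-1).
Proof.
move=> oU f0; elim: k => [|k IH] cf.
  by split=> // y Uy; apply: differentiableV;
    [exact: Ck_differentiable cf Uy|exact: f0].
split=> [y Uy|i].
  by apply: differentiableV; [exact: Ck_differentiable cf Uy|exact: f0].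
have ck := IH (CkS cf).
have cfi : Ck U k (cst (-1) * (partial i f *
    ((fun y => (f y)^-1) * (fun y => (f y)^-1)))).
  apply: CkM => //; first exact: Ck_cst.
  by apply: CkM => //; [case: cf => _; apply|exact: CkM].
apply: Ck_ext oU _ cfi => y Uy.
rewrite /partial deriveV//; last 2 first.
- exact: f0.
- by apply: diff_derivable; exact: Ck_differentiable cf Uy.
rewrite -[LHS]/(-1 * ('D_(delta_mx 0 i) f y * ((f y)^-1 * (f y)^-1))).
by rewrite -[RHS]/(- (f y) ^- 2 * _) -expr2 exprVn; ring.
Qed.

Lemma derive_coord (j : 'I_n) (v x : 'rV[R]_n) :
  'D_v (fun y : 'rV[R]_n => y 0 j) x = v 0 j.
Proof.
have := @derive_mx _ _ 1 n id x v (@derivable_id _ _ _ _).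
by rewrite derive_id => /matrixP/(_ 0 j); rewrite !mxE => <-.
Qed.

Lemma partial_coord (j i : 'I_n) :
  partial i (fun x : 'rV[R]_n => x 0 j) = cst (i == j)%:R.
Proof.
by rewrite funeqE => x; rewrite /partial derive_coord mxE eqxx eq_sym.
Qed.

Lemma Ck_coord U k (j : 'I_n) : Ck U k (fun x => x 0 j).
Proof.
case: k => [|k]; split=> //.
- by move=> y _; exact: differentiable_coord.
- by move=> y _; exact: differentiable_coord.
by move=> i; rewrite partial_coord; exact: Ck_cst.
Qed.

Lemma smooth_nearP f x : smooth_near f x <->
  exists U, [/\ open U, U x & forall k, Ck U k f].
Proof.
split=> [|[U [oU Ux cf]]]; last first.
  apply: filterS (open_nbhs_nbhs (conj oU Ux)) => y Uy s.
  elim/last_ind: s f cf => [|s i IH] f cf; first exact: Ck_differentiable (cf 0%N) Uy.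
  by rewrite foldr_rcons; apply: IH => k; case: (cf k.+1) => _; apply.
move=> /near_open[U [oU Ux Uf]]; exists U; split=> // k.
suff : forall f, (forall y, U y -> forall s, differentiable (foldr partial f s) y) ->
    Ck U k f by apply; exact: Uf.
elim: k => [|k IH] g Ug; split=> //.
- by move=> y Uy; exact: (Ug y Uy [::]).
- by move=> y Uy; exact: (Ug y Uy [::]).
by move=> i; apply: IH => y Uy s; have := Ug y Uy (rcons s i); rewrite foldr_rcons.
Qed.

End SmoothFunctions.

(** By the chain rule a partial derivative of the composite is a sum of products of a partial
    derivative of [F] with [partial j f \o F], again a composite but of one order less. *)
Lemma Ck_comp (R : realType) n m (U : set 'rV[R]_n) (V : set 'rV[R]_m) k
    (F : 'rV[R]_n -> 'rV[R]_m) (f : 'rV[R]_m -> R) :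
  open U -> (forall x, U x -> V (F x)) ->
  (forall j, Ck U k (fun x => F x 0 j)) -> Ck V k f -> Ck U k (f \o F).
Proof.
move=> oU UV; elim: k f => [|k IH] f cF cf.
  split=> // y Uy; apply: differentiable_comp.
    by apply: differentiable_row => j; exact: Ck_differentiable (cF j) Uy.
  by apply: Ck_differentiable cf _; exact: UV.
have dF y : U y -> forall j, differentiable (fun x => F x 0 j) y.
  by move=> Uy j; exact: Ck_differentiable (cF j) Uy.
have df y : U y -> differentiable f (F y).
  by move=> Uy; apply: Ck_differentiable cf _; exact: UV.
split=> [y Uy|i].
  by apply: differentiable_comp; [exact/differentiable_row/dF|exact: df].
suff cs : Ck U k (fun x => \sum_j
    (partial i (fun x => F x 0 j) * (partial j f \o F)) x).
  apply: Ck_ext oU _ cs => y Uy.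
  by rewrite [RHS]derive_comp_row//; [exact: dF|exact: df].
apply: Ck_sum => // j _; apply: CkM => //.
  by case: (cF j) => _; apply.
by apply: IH => [l|]; [exact: CkS|case: cf => _; apply].
Qed.

Section SmoothNear.
Context {R : realType} {n : nat}.
Implicit Types (f g : 'rV[R]_n -> R) (x : 'rV[R]_n).

Lemma smooth_near_near f x : smooth_near f x ->
  \forall y \near x, smooth_near f y.
Proof. exact: nbhs_interior. Qed.

Lemma smooth_near_differentiable f x : smooth_near f x -> differentiable f x.
Proof. by move/nbhs_singleton/(_ [::]). Qed.

Lemma smooth_near_partial f x i : smooth_near f x -> smooth_near (partial i f) x.
Proof. by apply: filterS => y H s; have := H (rcons s i); rewrite foldr_rcons. Qed.

Lemma smooth_near_derive f x (v : 'rV[R]_n) : smooth_near f x ->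
  smooth_near ('D_v f) x.
Proof.
move=> /smooth_nearP[U [oU Ux cf]]; apply/smooth_nearP; exists U; split=> // k.
have cs : Ck U k (fun y => \sum_j (cst (v 0 j) * partial j f) y).
  apply: Ck_sum => // j _; apply: CkM => //; first exact: Ck_cst.
  by case: (cf k.+1) => _; apply.
apply: Ck_ext oU _ cs => y Uy.
by rewrite derive_row_sum//; exact: Ck_differentiable (cf 0%N) Uy.
Qed.

Lemma smooth_near_ext f g x : (\forall y \near x, f y = g y) ->
  smooth_near f x -> smooth_near g x.
Proof.
move=> /near_open[V [oV Vx Vfg]] /smooth_nearP[U [oU Ux cf]].
apply/smooth_nearP; exists (U `&` V); split=> // [|k]; first exact: openI.
apply: (@Ck_ext _ _ _ _ f); first exact: openI.
  by move=> y [_ /Vfg].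
by apply: Ck_sub (cf k) => y [].
Qed.

Lemma smooth_near_cst x (a : R) : smooth_near (cst a) x.
Proof.
apply/smooth_nearP; exists setT; split=> // [|k]; first exact: openT.
exact: Ck_cst.
Qed.

Lemma smooth_nearD f g x : smooth_near f x -> smooth_near g x ->
  smooth_near (f + g) x.
Proof.
move=> /smooth_nearP[U [oU Ux cf]] /smooth_nearP[V [oV Vx cg]].
apply/smooth_nearP; exists (U `&` V); split=> // [|k]; first exact: openI.
apply: CkD; first exact: openI.
  by apply: Ck_sub (cf k) => y [].
by apply: Ck_sub (cg k) => y [].
Qed.

Lemma smooth_nearM f g x : smooth_near f x -> smooth_near g x ->
  smooth_near (f * g) x.
Proof.
move=> /smooth_nearP[U [oU Ux cf]] /smooth_nearP[V [oV Vx cg]].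
apply/smooth_nearP; exists (U `&` V); split=> // [|k]; first exact: openI.
apply: CkM; first exact: openI.
  by apply: Ck_sub (cf k) => y [].
by apply: Ck_sub (cg k) => y [].
Qed.

Lemma smooth_nearV f x : smooth_near f x -> f x != 0 ->
  smooth_near (fun y => (f y)^-1) x.
Proof.
move=> sf fx0; have := sf => /smooth_nearP[U [oU Ux cf]].
have fx : {for x, continuous f}.
  exact/differentiable_continuous/smooth_near_differentiable.
have : \forall y \near x, f y != 0.
  exact: (cvgr_neq0 (f x) fx fx0).
move=> /near_open[V [oV Vx Vf]].
apply/smooth_nearP; exists (U `&` V); split=> // [|k]; first exact: openI.
apply: CkV; first exact: openI.
  by move=> y [_ /Vf].
by apply: Ck_sub (cf k) => y [].
Qed.

Lemma smooth_near_coord x j : smooth_near (fun y => y 0 j) x.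
Proof.
apply/smooth_nearP; exists setT; split=> // [|k]; first exact: openT.
exact: Ck_coord.
Qed.

Lemma smooth_near_commute f x (v w : 'rV[R]_n) : smooth_near f x ->
  'D_w ('D_v f) x = 'D_v ('D_w f) x.
Proof.
move=> sf; apply: derive_commute.
- by near do apply: smooth_near_differentiable; exact: smooth_near_near.
- by near do apply: smooth_near_differentiable; exact/smooth_near_near/smooth_near_derive.
- by near do apply: smooth_near_differentiable; exact/smooth_near_near/smooth_near_derive.
- by apply/differentiable_continuous/smooth_near_differentiable; do 2!apply: smooth_near_derive.
- by apply/differentiable_continuous/smooth_near_differentiable; do 2!apply: smooth_near_derive.
Unshelve. all: by end_near. Qed.

End SmoothNear.

Lemma smooth_near_comp (R : realType) n m (F : 'rV[R]_n -> 'rV[R]_m)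
    (f : 'rV[R]_m -> R) (x : 'rV[R]_n) :
  (forall j, smooth_near (fun x => F x 0 j) x) -> smooth_near f (F x) ->
  smooth_near (f \o F) x.
Proof.
move=> sF sf; have [V [oV Vx cf]] := (smooth_nearP f (F x)).1 sf.
have dF : differentiable F x.
  by apply: differentiable_row => j; exact: smooth_near_differentiable.
have nV : \forall y \near x, V (F y).
  by apply: (differentiable_continuous dF); exact: open_nbhs_nbhs.
(* A single neighbourhood has to serve all coordinates of [F] and all orders; it exists because
   there are finitely many coordinates. *)
have : \forall y \near x,
    V (F y) /\ (forall j, forall s, differentiable (foldr partial (fun x => F x 0 j) s) y).
  near=> y; split; first by near: y.
  by near: y; apply: filter_forall => j; exact: sF.
move=> /near_open[W [oW Wx WF]].
apply/smooth_nearP; exists W; split=> // k.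
apply: (@Ck_comp _ _ _ _ V) => // [y /WF[]//|j].
suff : forall g, (forall y, W y -> forall s, differentiable (foldr partial g s) y) ->
    Ck W k g by apply=> y /WF[_]; exact.
elim: k => [|k IH] g Wg; split=> //.
- by move=> y Wy; exact: (Wg y Wy [::]).
- by move=> y Wy; exact: (Wg y Wy [::]).
by move=> i; apply: IH => y Wy s; have := Wg y Wy (rcons s i); rewrite foldr_rcons.
Unshelve. all: by end_near. Qed.

(** * Charts, tangent vectors and vector fields *)

(** The local part of [smooth_manifold], which passes to products by [prod_smooth_atlas]. *)
Record smooth_atlas (R : realType) (M : topologicalType) (n : nat)
    (A : set (chart R M n)) : Prop := {
  atlas_chart : forall u, A u -> is_chart u;
  atlas_cover : forall p, exists2 u, A u & dom u p;
  atlas_compatible : forall u v, A u -> A v -> compatible u v }.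

Section Charts.
Context {R : realType} {M : topologicalType} {n : nat}.
Implicit Types (u v : chart R M n) (p q : M) (P : M -> Prop).

Lemma near_dom u p : is_chart u -> dom u p -> \forall q \near p, dom u q.
Proof. by move=> hu up; exact: open_nbhs_nbhs (conj (chart_open_dom hu) up). Qed.

Lemma near_img u p : is_chart u -> dom u p ->
  \forall x \near cmap u p, cmap u (cinv u x) = x.
Proof.
move=> hu up.
have ip : (cmap u @` dom u) (cmap u p) by exists p.
apply: filterS (open_nbhs_nbhs (conj (chart_open_img hu) ip)) => x [q uq <-].
by rewrite (chart_cancel hu).
Qed.

Lemma near_cinv u p P : is_chart u -> dom u p ->
  (\forall q \near p, P q) -> \forall x \near cmap u p, P (cinv u x).
Proof.
move=> hu up nP; have ip : (cmap u @` dom u) (cmap u p) by exists p.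
by apply: (chart_inv_cont hu ip); rewrite (chart_cancel hu up).
Qed.

Lemma near_cmap u p (P : 'rV[R]_n -> Prop) : is_chart u -> dom u p ->
  (\forall x \near cmap u p, P x) -> \forall q \near p, P (cmap u q).
Proof. by move=> hu up nP; exact: (chart_cont hu up). Qed.

End Charts.

Definition xcoord (R : realType) (M : topologicalType) (n : nat)
  (u : chart R M n) (i : 'I_n) : M -> R := fun q => cmap u q 0 i.

(** Components are read off as values on the coordinate functions, so no coordinate vector
    representing [X] has to be chosen. *)
Definition tcoord (R : realType) (M : topologicalType) (n : nat)
  (u : chart R M n) (X : tvec R M) : 'rV[R]_n := \row_i X (xcoord u i).

Definition frame (R : realType) (M : topologicalType) (n : nat)
    (A : set (chart R M n)) (u : chart R M n) (i : 'I_n) : vfield R M :=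
  fun q => chart_tvec A u q (delta_mx 0 i).

Section Manifold.
Context {R : realType} {M : topologicalType} {n : nat}.
Variable A : set (chart R M n).
Hypothesis hA : smooth_atlas A.
Implicit Types (u v : chart R M n) (p q : M) (phi psi : M -> R).
Implicit Types (X Y : tvec R M) (Z : vfield R M).

(** [cinv u] inverts [cmap u] only on [dom u], hence an identity valid merely near the point. *)
Lemma near_transition u v p phi : A u -> A v -> dom u p -> dom v p ->
  \forall x \near cmap v p,
    (phi \o cinv v) x = ((phi \o cinv u) \o (cmap u \o cinv v)) x.
Proof.
move=> Au Av up vp; have hu := atlas_chart hA Au; have hv := atlas_chart hA Av.
apply: filterS (near_cinv hv vp (near_dom hu up)) => x ux /=.
by rewrite (chart_cancel hu ux).
Qed.

(** One chart is enough: reading [phi] in another chart composes it with a transition map, which is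
    smooth by compatibility. *)
Lemma smooth_at_chart u p phi : A u -> dom u p ->
  smooth_at A p phi <-> smooth_near (phi \o cinv u) (cmap u p).
Proof.
move=> Au up; split=> [|sphi v Av vp]; first by apply.
have := near_transition phi Au Av up vp.
move=> H; apply: smooth_near_ext.
  by apply: filterS H => x; apply: esym.
apply: smooth_near_comp; first exact: (atlas_compatible hA Av Au vp up).
by rewrite /= (chart_cancel (atlas_chart hA Av) vp).
Qed.

Lemma smooth_at_ext p phi psi : (\forall q \near p, phi q = psi q) ->
  smooth_at A p phi -> smooth_at A p psi.
Proof.
move=> e sphi u Au up; apply: smooth_near_ext (sphi u Au up).
exact: (near_cinv (atlas_chart hA Au) up e).
Qed.

Lemma smooth_at_near p phi : smooth_at A p phi ->
  \forall q \near p, smooth_at A q phi.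
Proof.
move=> sphi; have [u Au up] := atlas_cover hA p.
have hu := atlas_chart hA Au.
near=> q; apply/(@smooth_at_chart u); first exact: Au.
  by near: q; exact: near_dom.
by near: q; apply: near_cmap => //; exact/smooth_near_near/sphi.
Unshelve. all: by end_near. Qed.

Lemma smooth_at_cst p (a : R) : smooth_at A p (fun=> a).
Proof. by move=> u _ _; exact: smooth_near_cst. Qed.

Lemma smooth_atD p phi psi : smooth_at A p phi -> smooth_at A p psi ->
  smooth_at A p (fun q => phi q + psi q).
Proof.
by move=> s1 s2 u Au up; exact: smooth_nearD (s1 u Au up) (s2 u Au up).
Qed.

Lemma smooth_atM p phi psi : smooth_at A p phi -> smooth_at A p psi ->
  smooth_at A p (fun q => phi q * psi q).
Proof.
by move=> s1 s2 u Au up; exact: smooth_nearM (s1 u Au up) (s2 u Au up).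
Qed.

Lemma smooth_atN p phi : smooth_at A p phi -> smooth_at A p (fun q => - phi q).
Proof.
move=> s; apply: (@smooth_at_ext _ (fun q => -1 * phi q)).
  by near=> q; rewrite mulN1r.
by apply: smooth_atM => //; exact: smooth_at_cst.
Unshelve. all: by end_near. Qed.

Lemma smooth_atB p phi psi : smooth_at A p phi -> smooth_at A p psi ->
  smooth_at A p (fun q => phi q - psi q).
Proof. by move=> s1 s2; apply: smooth_atD => //; exact: smooth_atN. Qed.

Lemma smooth_atX p phi k : smooth_at A p phi ->
  smooth_at A p (fun q => phi q ^+ k).
Proof.
move=> s; elim: k => [|k IH].
  by under eq_fun do rewrite expr0; exact: smooth_at_cst.
by under eq_fun do rewrite exprS; exact: smooth_atM.
Qed.

Lemma smooth_atV p phi : smooth_at A p phi -> phi p != 0 ->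
  smooth_at A p (fun q => (phi q)^-1).
Proof.
move=> s p0 u Au up; apply: smooth_nearV; first exact: s.
by rewrite /= (chart_cancel (atlas_chart hA Au)).
Qed.

Lemma smooth_at_sum p (I : Type) (r : seq I) (P : pred I) (F : I -> M -> R) :
  (forall i, P i -> smooth_at A p (F i)) ->
  smooth_at A p (fun q => \sum_(i <- r | P i) F i q).
Proof.
move=> sF; elim: r => [|i r IH].
  by under eq_fun do rewrite big_nil; exact: smooth_at_cst.
under eq_fun do rewrite big_cons.
by case Pi : (P i) => //; apply: smooth_atD => //; exact: sF.
Qed.

Lemma smooth_at_prod p (I : Type) (r : seq I) (P : pred I) (F : I -> M -> R) :
  (forall i, P i -> smooth_at A p (F i)) ->
  smooth_at A p (fun q => \prod_(i <- r | P i) F i q).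
Proof.
move=> sF; elim: r => [|i r IH].
  by under eq_fun do rewrite big_nil; exact: smooth_at_cst.
under eq_fun do rewrite big_cons.
by case Pi : (P i) => //; apply: smooth_atM => //; exact: sF.
Qed.

Lemma smooth_at_xcoord u p i : A u -> dom u p -> smooth_at A p (xcoord u i).
Proof.
move=> Au up; apply/(smooth_at_chart _ Au up).
apply: (@smooth_near_ext _ _ (fun x => x 0 i)); last exact: smooth_near_coord.
have := near_img (atlas_chart hA Au) up.
by apply: filterS => x xE; rewrite /xcoord /= xE.
Qed.

Lemma chart_tvecE u p a phi : smooth_at A p phi ->
  chart_tvec A u p a phi = 'D_a (phi \o cinv u) (cmap u p).
Proof. by move=> s; rewrite /chart_tvec asboolT. Qed.

Lemma tangent_nsmooth p X phi : tangent A p X -> ~ smooth_at A p phi -> X phi = 0.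
Proof. by move=> [u [a [_ _ ->]]] s; rewrite /chart_tvec asboolF. Qed.

Lemma chart_tvec_tangent u p a : A u -> dom u p -> tangent A p (chart_tvec A u p a).
Proof. by move=> Au up; exists u, a. Qed.

Lemma derivable_chart u p phi (a : 'rV[R]_n) : A u -> dom u p ->
  smooth_at A p phi -> derivable (phi \o cinv u) (cmap u p) a.
Proof.
move=> Au up s; apply: diff_derivable.
exact/smooth_near_differentiable/s.
Qed.

(** Both sides are 0 on functions that are not smooth near [p], so the expansion holds for every
    [phi] and yields equalities of operators. *)
Lemma chart_tvec_sum u p a phi : A u -> dom u p ->
  chart_tvec A u p a phi = \sum_i a 0 i * frame A u i p phi.
Proof.
move=> Au up; case: (pselect (smooth_at A p phi)) => [s|ns]; last first.
  rewrite /frame /chart_tvec asboolF// big1// => i _.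
  by rewrite mulr0.
rewrite chart_tvecE// derive_row_sum; last exact/smooth_near_differentiable/s.
by apply: eq_bigr => i _; rewrite /frame chart_tvecE.
Qed.

(** Change of chart: this is the chain rule for the transition map, whose directional derivatives
    are the values of [X] on the coordinate functions of [u]. *)
Lemma tangent_chartE u p X : A u -> dom u p -> tangent A p X ->
  X = chart_tvec A u p (tcoord u X).
Proof.
move=> Au up [v [b [Av vp XE]]]; rewrite funeqE => phi.
case: (pselect (smooth_at A p phi)) => [s|ns]; last first.
  by rewrite XE /chart_tvec !asboolF.
have hv := atlas_chart hA Av.
rewrite chart_tvecE// derive_row_sum; last exact/smooth_near_differentiable/s.
rewrite {1}XE chart_tvecE// (near_eq_derive _ (near_transition phi Au Av up vp)).
have sx i := smooth_at_xcoord i Au up.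
rewrite derive_comp_row.
- apply: eq_bigr => j _; rewrite /= (chart_cancel hv vp) mxE XE chart_tvecE//.
- move=> j; apply: smooth_near_differentiable.
  exact: (atlas_compatible hA Av Au vp up).
- by rewrite /= (chart_cancel hv vp); exact/smooth_near_differentiable/s.
Qed.

Lemma tangent_sum_frame u p X phi : A u -> dom u p -> tangent A p X ->
  X phi = \sum_i X (xcoord u i) * frame A u i p phi.
Proof.
move=> Au up tX; rewrite {1}(tangent_chartE Au up tX) chart_tvec_sum//.
by apply: eq_bigr => i _; rewrite mxE.
Qed.

Lemma tcoord_chart_tvec u p a : A u -> dom u p ->
  tcoord u (chart_tvec A u p a) = a.
Proof.
move=> Au up; apply/rowP => i; rewrite mxE chart_tvecE; last exact: smooth_at_xcoord.
rewrite (@near_eq_derive _ _ _ _ (fun x : 'rV[R]_n => x 0 i)); last first.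
  have := near_img (atlas_chart hA Au) up.
  by apply: filterS => x xE; rewrite /xcoord /= xE.
exact: derive_coord.
Qed.

Lemma frame_xcoord u p i j : A u -> dom u p ->
  frame A u i p (xcoord u j) = (i == j)%:R.
Proof.
move=> Au up; have /rowP/(_ j) := tcoord_chart_tvec (delta_mx 0 i) Au up.
by rewrite !mxE /= eq_sym.
Qed.

Lemma tangent_inj u p X Y : A u -> dom u p -> tangent A p X -> tangent A p Y ->
  (forall i, X (xcoord u i) = Y (xcoord u i)) -> X = Y.
Proof.
move=> Au up tX tY e; rewrite (tangent_chartE Au up tX) (tangent_chartE Au up tY).
by congr chart_tvec; apply/rowP => i; rewrite !mxE.
Qed.

Lemma tangent_lin p (a : R) X Y : tangent A p X -> tangent A p Y ->
  tangent A p (fun phi => a * X phi + Y phi).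
Proof.
have [u Au up] := atlas_cover hA p.
move=> tX tY; exists u, (a *: tcoord u X + tcoord u Y); split=> //.
rewrite funeqE => phi; rewrite chart_tvec_sum//.
rewrite (tangent_sum_frame phi Au up tX) (tangent_sum_frame phi Au up tY).
rewrite mulr_sumr -big_split/=; apply: eq_bigr => i _.
by rewrite !mxE; ring.
Qed.

Lemma tangent0 p : tangent A p (fun=> 0).
Proof.
have [u Au up] := atlas_cover hA p.
exists u, 0; split=> //; rewrite funeqE => phi; rewrite chart_tvec_sum//.
by rewrite big1// => i _; rewrite mxE mul0r.
Qed.

Lemma tangent_cst p X (a : R) : tangent A p X -> X (fun=> a) = 0.
Proof.
move=> [u [b [Au up ->]]]; rewrite chart_tvecE; last exact: smooth_at_cst.
exact: derive_cst.
Qed.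

Lemma tangentD p X phi psi : tangent A p X ->
  smooth_at A p phi -> smooth_at A p psi ->
  X (fun q => phi q + psi q) = X phi + X psi.
Proof.
move=> [u [b [Au up ->]]] s1 s2; rewrite !chart_tvecE//; last exact: smooth_atD.
by rewrite -deriveD//; exact: derivable_chart.
Qed.

Lemma tangentM p X phi psi : tangent A p X ->
  smooth_at A p phi -> smooth_at A p psi ->
  X (fun q => phi q * psi q) = X phi * psi p + phi p * X psi.
Proof.
move=> [u [b [Au up ->]]] s1 s2; rewrite !chart_tvecE//; last exact: smooth_atM.
rewrite (_ : _ \o _ = (phi \o cinv u) * (psi \o cinv u))// deriveM.
- rewrite -[LHS]/(phi (cinv u (cmap u p)) * _ + psi (cinv u (cmap u p)) * _).
  by rewrite (chart_cancel (atlas_chart hA Au) up); ring.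
- exact: derivable_chart.
- exact: derivable_chart.
Qed.

Lemma tangentZ p X (a : R) phi : tangent A p X ->
  smooth_at A p phi -> X (fun q => a * phi q) = a * X phi.
Proof.
move=> tX s; rewrite (tangentM tX (smooth_at_cst a) s).
by rewrite (tangent_cst _ tX) mul0r add0r.
Qed.

Lemma tangentB p X phi psi : tangent A p X ->
  smooth_at A p phi -> smooth_at A p psi ->
  X (fun q => phi q - psi q) = X phi - X psi.
Proof.
move=> tX s1 s2; rewrite (tangentD tX s1 (smooth_atN s2)); congr (_ + _).
under eq_fun do rewrite -mulN1r.
by rewrite (tangentZ _ tX s2) mulN1r.
Qed.

Lemma tangent_sum p X (I : Type) (r : seq I) (P : pred I) (F : I -> M -> R) :
  tangent A p X -> (forall i, P i -> smooth_at A p (F i)) ->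
  X (fun q => \sum_(i <- r | P i) F i q) = \sum_(i <- r | P i) X (F i).
Proof.
move=> tX sF; elim: r => [|i r IH].
  by under eq_fun do rewrite big_nil; rewrite big_nil (tangent_cst _ tX).
under eq_fun do rewrite big_cons.
rewrite big_cons; case Pi : (P i) => //.
by rewrite (tangentD tX (sF _ Pi)) ?IH//; exact: smooth_at_sum.
Qed.

(** The non-smooth case is covered because smoothness near [p] is itself a property of the germ.
    This lemma is what permits differentiating formulas that hold only on a chart domain. *)
Lemma tangent_near p X phi psi : tangent A p X ->
  (\forall q \near p, phi q = psi q) -> X phi = X psi.
Proof.
move=> tX e; case: (pselect (smooth_at A p phi)) => [s|ns]; last first.
  rewrite (tangent_nsmooth tX ns) (tangent_nsmooth tX)// => s; apply: ns.
  apply: smooth_at_ext s.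
  by apply: filterS e => q ->.
have s' := smooth_at_ext e s.
move: tX => [u [b [Au up ->]]]; rewrite !chart_tvecE//.
by apply: near_eq_derive; exact: near_cinv (atlas_chart hA Au) up e.
Qed.

(** Apply [X] to [phi] times its inverse, which is 1 near [p], and solve the product rule. *)
Lemma tangentV p X phi : tangent A p X -> smooth_at A p phi -> phi p != 0 ->
  X (fun q => (phi q)^-1) = - X phi / phi p ^+ 2.
Proof.
move=> tX s p0; have sV := smooth_atV s p0.
have : X (fun q => phi q * (phi q)^-1) = 0.
  rewrite (@tangent_near _ _ _ (fun=> 1) tX); first exact: tangent_cst tX.
  have [u Au up] := atlas_cover hA p.
  have hu := atlas_chart hA Au.
  (* Nonvanishing near [p] is obtained in the chart, where differentiability gives continuity, and
     carried back by [near_cmap]. *)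
  have : {for cmap u p, continuous (phi \o cinv u)}.
    exact/differentiable_continuous/smooth_near_differentiable/s.
  move=> cphi; have : \forall x \near cmap u p, (phi \o cinv u) x != 0.
    by apply: (cvgr_neq0 _ cphi); rewrite /= (chart_cancel hu up).
  move=> /(near_cmap hu up) nz; near=> q; rewrite mulfV//.
  have uq : dom u q by near: q; exact: near_dom.
  rewrite -(chart_cancel hu uq) -[phi _]/((phi \o cinv u) (cmap u q)).
  by near: q.
rewrite (tangentM tX s sV) => /eqP; rewrite addrC addr_eq0 => /eqP e.
apply: (mulfI p0); rewrite e; field.
by rewrite p0.
Unshelve. all: by end_near. Qed.

Lemma frame_tangent u p i : A u -> dom u p -> tangent A p (frame A u i p).
Proof. by move=> Au up; exact: chart_tvec_tangent. Qed.

Lemma smooth_at_frame u p i phi : A u -> dom u p -> smooth_at A p phi ->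
  smooth_at A p (fun q => frame A u i q phi).
Proof.
move=> Au up s; have hu := atlas_chart hA Au.
apply/(smooth_at_chart _ Au up).
apply: (@smooth_near_ext _ _ (partial i (phi \o cinv u))); last first.
  exact/smooth_near_partial/s.
near=> x; rewrite /= /frame chart_tvecE; last first.
  by near: x; exact: near_cinv hu up (smooth_at_near s).
have -> : cmap u (cinv u x) = x by near: x; exact: near_img.
by [].
Unshelve. all: by end_near. Qed.

Lemma smooth_field_tangent p Z : smooth_field_at A p Z -> tangent A p (Z p).
Proof. by move=> [/nbhs_singleton]. Qed.

Lemma smooth_field_apply p Z phi : smooth_field_at A p Z -> smooth_at A p phi ->
  smooth_at A p (fun q => Z q phi).
Proof. by move=> [_]; exact. Qed.

(** Coordinate functions suffice as tests, since the value of [Z] on any [phi] expands along the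
    coordinate frame with these values as coefficients. *)
Lemma smooth_field_intro u p Z : A u -> dom u p ->
  (\forall q \near p, tangent A q (Z q)) ->
  (forall i, smooth_at A p (fun q => Z q (xcoord u i))) ->
  smooth_field_at A p Z.
Proof.
move=> Au up tZ sZ; split=> // phi s.
apply: (@smooth_at_ext _
    (fun q => \sum_i Z q (xcoord u i) * frame A u i q phi)).
  near=> q; apply: esym; apply: tangent_sum_frame => //.
    by near: q; exact: near_dom (atlas_chart hA Au) up.
  by near: q.
apply: smooth_at_sum => i _; apply: smooth_atM => //.
exact: smooth_at_frame.
Unshelve. all: by end_near. Qed.

Lemma frame_smooth u p i : A u -> dom u p -> smooth_field_at A p (frame A u i).
Proof.
move=> Au up; have ud := near_dom (atlas_chart hA Au) up.
apply: (smooth_field_intro Au up) => [|j].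
  by apply: filterS ud => q; exact: frame_tangent.
apply: (@smooth_at_ext _ (fun=> (i == j)%:R)); last exact: smooth_at_cst.
by apply: filterS ud => q uq; rewrite frame_xcoord.
Qed.

Lemma smooth_field_chart u p (a : M -> 'rV[R]_n) : A u -> dom u p ->
  (forall i, smooth_at A p (fun q => a q 0 i)) ->
  smooth_field_at A p (fun q => chart_tvec A u q (a q)).
Proof.
move=> Au up sa; have ud := near_dom (atlas_chart hA Au) up.
apply: (smooth_field_intro Au up) => [|j].
  by apply: filterS ud => q; exact: chart_tvec_tangent.
apply: smooth_at_ext (sa j).
apply: filterS ud => q uq; have /rowP/(_ j) := tcoord_chart_tvec (a q) Au uq.
by rewrite mxE.
Qed.

Lemma smooth_field_near p Z : smooth_field_at A p Z ->
  \forall q \near p, smooth_field_at A q Z.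
Proof.
move=> sZ; have [u Au up] := atlas_cover hA p.
have hu := atlas_chart hA Au.
have tZ : \forall q \near p, \forall q' \near q, tangent A q' (Z q').
  by case: sZ => tZ _; apply: nbhs_interior.
near=> q; have uq : dom u q by near: q; exact: near_dom.
apply: (smooth_field_intro Au uq); first by near: q.
near: q; apply: filter_forall => i; apply: smooth_at_near.
by apply: (smooth_field_apply sZ); exact: smooth_at_xcoord.
Unshelve. all: by end_near. Qed.

Lemma smooth_field_near_ext p (Y Z : vfield R M) :
  (\forall q \near p, Y q = Z q) -> smooth_field_at A p Y -> smooth_field_at A p Z.
Proof.
move=> e [tY sY]; split=> [|phi s].
  by near=> q; have <- : Y q = Z q by [near: q]; near: q.
apply: smooth_at_ext (sY phi s).
by apply: filterS e => q ->.
Unshelve. all: by end_near. Qed.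

(** In the chart both sides are iterated directional derivatives of one function, and these
    commute. *)
Lemma frame_commute u p i j phi : A u -> dom u p -> smooth_at A p phi ->
  frame A u i p (fun q => frame A u j q phi) =
  frame A u j p (fun q => frame A u i q phi).
Proof.
have H k l : A u -> dom u p -> smooth_at A p phi ->
    frame A u k p (fun q => frame A u l q phi) =
    'D_(delta_mx 0 k) ('D_(delta_mx 0 l) (phi \o cinv u)) (cmap u p).
  move=> Au up s; have hu := atlas_chart hA Au.
  rewrite {1}/frame chart_tvecE; last exact: smooth_at_frame.
  apply: near_eq_derive; near=> x; rewrite /= /frame chart_tvecE; last first.
    by near: x; exact: near_cinv hu up (smooth_at_near s).
  by have -> : cmap u (cinv u x) = x by near: x; exact: near_img.
move=> Au up s; rewrite (H i j Au up s) (H j i Au up s).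
by apply: smooth_near_commute; exact: s.
Unshelve. all: by end_near. Qed.

(** The bracket is a first-order operator: the second derivatives produced by the two compositions
    form [second], which is symmetric because coordinate frames commute, and they cancel. *)
Lemma bracketE u p (Y Z : vfield R M) phi : A u -> dom u p ->
  smooth_field_at A p Y -> smooth_field_at A p Z -> smooth_at A p phi ->
  Y p (fun q => Z q phi) - Z p (fun q => Y q phi) =
  \sum_k (Y p (fun q => Z q (xcoord u k)) - Z p (fun q => Y q (xcoord u k)))
    * frame A u k p phi.
Proof.
move=> Au up sY sZ s.
pose second (V W : vfield R M) :=
  \sum_k \sum_l W p (xcoord u k) * V p (xcoord u l)
        * frame A u l p (fun q => frame A u k q phi).
have secondC V W : second V W = second W V.
  rewrite /second exchange_big/=; apply: eq_bigr => k _; apply: eq_bigr => l _.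
  by rewrite (frame_commute k l Au up s) [W _ _ * _]mulrC.
have H (V W : vfield R M) : smooth_field_at A p V -> smooth_field_at A p W ->
    V p (fun q => W q phi) =
    \sum_k V p (fun q => W q (xcoord u k)) * frame A u k p phi
    + second V W.
  move=> sV sW; have tV := smooth_field_tangent sV.
  have sx k := smooth_at_xcoord k Au up.
  have sWx k := smooth_field_apply sW (sx k).
  have sf k := smooth_at_frame k Au up s.
  rewrite (@tangent_near _ _ _
    (fun q => \sum_k W q (xcoord u k) * frame A u k q phi) tV); last first.
    near=> q; apply: tangent_sum_frame => //.
      by near: q; exact: near_dom (atlas_chart hA Au) up.
    by near: q; case: sW.
  rewrite (tangent_sum _ tV); last by move=> k _; exact: smooth_atM.
  rewrite -big_split/=; apply: eq_bigr => k _.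
  rewrite (tangentM tV (sWx k) (sf k)); congr (_ + _).
  rewrite (tangent_sum_frame (fun q => frame A u k q phi) Au up tV) mulr_sumr.
  by apply: eq_bigr => l _; ring.
rewrite (H Y Z sY sZ) (H Z Y sZ sY) (secondC Z Y).
rewrite opprD addrACA subrr addr0 -sumrB.
by apply: eq_bigr => k _; rewrite mulrBl.
Unshelve. all: by end_near. Qed.

End Manifold.

(** * Gram matrix, gradient and divergence *)

Section SmoothMatrix.
Context {R : realType} {M : topologicalType} {n : nat}.
Variable A : set (chart R M n).
Hypothesis hA : smooth_atlas A.

Lemma smooth_at_det p k (B : M -> 'M[R]_k) :
  (forall i j, smooth_at A p (fun q => B q i j)) ->
  smooth_at A p (fun q => \det (B q)).
Proof.
move=> sB; apply: smooth_at_sum => s _; apply: smooth_atM.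
  exact: smooth_at_cst.
exact: smooth_at_prod.
Qed.

Lemma smooth_at_mulmx p k l m (B : M -> 'M[R]_(k, l)) (C : M -> 'M[R]_(l, m)) :
  (forall i j, smooth_at A p (fun q => B q i j)) ->
  (forall i j, smooth_at A p (fun q => C q i j)) ->
  forall i j, smooth_at A p (fun q => (B q *m C q) i j).
Proof.
move=> sB sC i j; under eq_fun do rewrite mxE.
by apply: smooth_at_sum => s _; exact: smooth_atM.
Qed.

(** By Cramer's rule the entries of the inverse are cofactors divided by the determinant, all
    polynomial in the entries of [B]. *)
Lemma smooth_at_invmx p k (B : M -> 'M[R]_k) :
  (forall i j, smooth_at A p (fun q => B q i j)) ->
  (\forall q \near p, B q \in unitmx) ->
  forall i j, smooth_at A p (fun q => invmx (B q) i j).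
Proof.
move=> sB uB i j.
apply: (@smooth_at_ext _ _ _ _ hA _
    (fun q => (\det (B q))^-1 * ((-1) ^+ (j + i) * \det (row' j (col' i (B q)))))).
  by near=> q; have uBq : B q \in unitmx by [near: q]; rewrite /invmx uBq !mxE.
apply: smooth_atM.
  apply: (smooth_atV hA); first exact: smooth_at_det.
  by rewrite -unitfE -unitmxE; exact: nbhs_singleton uB.
apply: smooth_atM; first exact: smooth_at_cst.
apply: smooth_at_det => k' l.
by apply: (smooth_at_ext hA _ (sB (lift j k') (lift i l))); near=> q; rewrite !mxE.
Unshelve. all: by end_near. Qed.

End SmoothMatrix.

Section Trace.
Context {R : realType} {M : topologicalType} {n : nat}.
Variable A : set (chart R M n).
Hypothesis hA : smooth_atlas A.

Lemma frame_tangent_frame u p : A u -> dom u p ->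
  tangent_frame A p (fun i => frame A u i p).
Proof.
move=> Au up; split=> [i|X tX]; first exact: frame_tangent.
exists (tcoord u X); split.
  rewrite funeqE => phi; rewrite (tangent_sum_frame hA _ Au up tX).
  by apply: eq_bigr => i _; rewrite mxE.
move=> a XE; apply/rowP => i; rewrite mxE XE (bigD1 i)//= big1.
  by rewrite (frame_xcoord hA)// eqxx mulr1 addr0.
by move=> j /negbTE ji; rewrite (frame_xcoord hA)// ji mulr0.
Qed.

(** [tangent_trace] picks the matrix of [L] in some frame. A change of frame conjugates it to the
    matrix in the coordinate frame, so the trace does not depend on the pick. *)
Lemma tangent_traceE u p (L : tvec R M -> tvec R M) : A u -> dom u p ->
  (forall X, tangent A p X -> tangent A p (L X)) ->
  (forall (a : R) X Y, tangent A p X -> tangent A p Y ->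
    L (fun phi => a * X phi + Y phi) = fun phi => a * L X phi + L Y phi) ->
  tangent_trace A p L = \sum_i L (frame A u i p) (xcoord u i).
Proof.
move=> Au up tL linL.
have L0 : L (fun=> 0) = fun=> 0.
  have := linL (-1) _ _ (tangent0 hA p) (tangent0 hA p).
  rewrite (_ : (fun _ => _) = fun=> 0); last by rewrite funeqE => ?; rewrite mulr0 addr0.
  by move=> e; rewrite e funeqE => phi; rewrite mulN1r addNr.
have tsum (r : seq 'I_n) (a : 'I_n -> R) :
    tangent A p (fun phi => \sum_(i <- r) a i * frame A u i p phi) /\
    L (fun phi => \sum_(i <- r) a i * frame A u i p phi) =
    fun phi => \sum_(i <- r) a i * L (frame A u i p) phi.
  elim: r => [|i r [tr IH]].
    under eq_fun do rewrite big_nil; split; first exact: tangent0.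
    by rewrite L0; under [RHS]eq_fun do rewrite big_nil.
  have tf := frame_tangent i Au up.
  under eq_fun do rewrite big_cons; split; first exact: (tangent_lin hA).
  by rewrite linL// IH; under [RHS]eq_fun do rewrite big_cons.
(* Row [j] is the image of the [j]-th frame vector, so [B] acts on row vectors from the right, while
   the matrix in [tangent_trace] acts on columns: hence the transposes. *)
pose B : 'M[R]_n := \matrix_(j, i) L (frame A u j p) (xcoord u i).
have LB X : tangent A p X -> tcoord u (L X) = tcoord u X *m B.
  move=> tX; apply/rowP => i; rewrite !mxE.
  have -> : X = fun phi => \sum_i X (xcoord u i) * frame A u i p phi.
    by rewrite funeqE => phi; exact: tangent_sum_frame tX.
  rewrite (tsum _ _).2; apply: eq_bigr => j _; rewrite !mxE.
  by rewrite -(tangent_sum_frame hA _ Au up tX).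
have -> : \sum_i L (frame A u i p) (xcoord u i) = \tr B.
  by apply: eq_bigr => i _; rewrite mxE.
rewrite /tangent_trace; case: xgetP => [_ -> [e [a [[te fe] La ->]]]|]; last first.
  move/(_ (\tr B)); case; exists (fun i => frame A u i p), B^T; split.
  - exact: frame_tangent_frame.
  - move=> j; rewrite funeqE => phi.
    rewrite (tangent_sum_frame hA _ Au up (tL _ (frame_tangent j Au up))).
    by apply: eq_bigr => i _; rewrite !mxE.
  - by rewrite mxtrace_tr.
(* The change of frame: row [j] holds the coordinates of [e j], and [T] intertwines [B] with the
   transpose of [a]. *)
pose T : 'M[R]_n := \matrix_(j, i) e j (xcoord u i).
have rowT j : row j T = tcoord u (e j) by apply/rowP => i; rewrite !mxE.
have TB : T *m B = a^T *m T.
  apply/row_matrixP => j; rewrite row_mul rowT -LB; last exact: te.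
  rewrite La; apply/rowP => i; rewrite !mxE.
  by apply: eq_bigr => k _; rewrite !mxE.
(* [T] is invertible because the coordinate frame in turn expands along [e]. *)
have [Q QT] : exists Q : 'M[R]_n, Q *m T = 1%:M.
  have H k : exists c : 'rV[R]_n, c *m T = row k 1%:M.
    have [c [ce _]] := fe _ (frame_tangent k Au up).
    exists c; apply/rowP => i; rewrite !mxE -(frame_xcoord hA k i Au up) ce.
    by apply: eq_bigr => j _; rewrite mxE.
  exists (\matrix_k sval (cid (H k))); apply/row_matrixP => k.
  by rewrite row_mul rowK; exact: svalP (cid (H k)).
have -> : B = Q *m (a^T *m T) by rewrite -TB mulmxA QT mul1mx.
by rewrite mxtrace_mulC -mulmxA (mulmx1C QT) mulmx1 mxtrace_tr.
Qed.

End Trace.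

Definition gram (R : realType) (M : topologicalType) (n : nat)
    (A : set (chart R M n)) (g : tensor2 R M) (u : chart R M n) (q : M) : 'M[R]_n :=
  \matrix_(i, j) g q (frame A u i q) (frame A u j q).

Section Metric.
Context {R : realType} {M : topologicalType} {n : nat}.
Variables (A : set (chart R M n)) (g : tensor2 R M).
Hypotheses (hA : smooth_atlas A) (hg : riemannian_metric A g).
Implicit Types (u : chart R M n) (p q : M) (phi f : M -> R).
Implicit Types (X Y Z : tvec R M).

Lemma metric0l p Y : tangent A p Y -> g p (fun=> 0) Y = 0.
Proof.
move=> tY; have t0 := tangent0 hA p.
have := metric_linear hg 1 t0 t0 tY.
rewrite (_ : (fun _ => _) = fun=> 0); last by rewrite funeqE => ?; rewrite mulr0 addr0.
by rewrite mul1r => /eqP; rewrite addrC -subr_eq subrr eq_sym => /eqP.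
Qed.

Lemma metric_suml p u Y (r : seq 'I_n) (a : 'I_n -> R) : A u -> dom u p ->
  tangent A p Y ->
  g p (fun phi => \sum_(i <- r) a i * frame A u i p phi) Y =
  \sum_(i <- r) a i * g p (frame A u i p) Y.
Proof.
move=> Au up tY.
(* [g] is linear on tangent vectors only, so the induction carries the tangency of the partial
   sums. *)
suff : tangent A p (fun phi => \sum_(i <- r) a i * frame A u i p phi) /\
    g p (fun phi => \sum_(i <- r) a i * frame A u i p phi) Y =
    \sum_(i <- r) a i * g p (frame A u i p) Y by case.
elim: r => [|i r [tr IH]].
  under eq_fun do rewrite big_nil; rewrite big_nil; split; first exact: tangent0.
  exact: metric0l.
have tf := frame_tangent i Au up.
under eq_fun do rewrite big_cons; split; first exact: (tangent_lin hA).
by rewrite (metric_linear hg)// IH big_cons.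
Qed.

Lemma gram_tr u q : A u -> dom u q -> (gram A g u q)^T = gram A g u q.
Proof.
move=> Au uq; apply/matrixP => i j; rewrite !mxE.
by apply: (Defs.metric_sym hg); exact: frame_tangent.
Qed.

Lemma metric_frame u p X j : A u -> dom u p -> tangent A p X ->
  g p X (frame A u j p) = (tcoord u X *m gram A g u p) 0 j.
Proof.
move=> Au up tX; rewrite mxE.
rewrite {1}(_ : X = fun phi => \sum_i X (xcoord u i) * frame A u i p phi).
  rewrite metric_suml//; last exact: frame_tangent.
  by apply: eq_bigr => i _; rewrite !mxE.
by rewrite funeqE => phi; exact: tangent_sum_frame tX.
Qed.

Lemma metric_gram u p X Y : A u -> dom u p -> tangent A p X -> tangent A p Y ->
  g p X Y = (tcoord u X *m gram A g u p *m (tcoord u Y)^T) 0 0.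
Proof.
move=> Au up tX tY; rewrite (Defs.metric_sym hg tX tY) mxE.
rewrite {1}(_ : Y = fun phi => \sum_i Y (xcoord u i) * frame A u i p phi).
  rewrite metric_suml//; apply: eq_bigr => j _.
  rewrite (Defs.metric_sym hg _ tX); last exact: frame_tangent.
  by rewrite metric_frame// [RHS]mulrC !mxE.
by rewrite funeqE => phi; exact: tangent_sum_frame tY.
Qed.

Lemma metric_ge0 p X : tangent A p X -> 0 <= g p X X.
Proof.
move=> tX; case: (pselect (X = fun=> 0)) => [->|X0].
  by rewrite metric0l//; exact: tangent0.
exact/ltW/(metric_pos hg).
Qed.

(** A row vector killed by the Gram matrix represents a tangent vector of zero length, which is 0 by
    positivity. *)
Lemma gram_unit u q : A u -> dom u q -> gram A g u q \in unitmx.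
Proof.
move=> Au uq; rewrite -row_free_unit; apply: inj_row_free => v vG.
have tX := chart_tvec_tangent v Au uq.
rewrite -(tcoord_chart_tvec hA v Au uq); apply/rowP => i; rewrite !mxE.
suff -> : chart_tvec A u q v = fun=> 0 by [].
apply: contrapT => X0; have := metric_pos hg tX X0.
by rewrite (metric_gram Au uq tX tX) (tcoord_chart_tvec hA)// vG mul0mx mxE ltxx.
Qed.

Lemma gram_smooth u p i j : A u -> dom u p ->
  smooth_at A p (fun q => gram A g u q i j).
Proof.
move=> Au up.
have s := metric_smooth hg (frame_smooth hA i Au up) (frame_smooth hA j Au up).
by apply: (smooth_at_ext hA _ s); near=> q; rewrite mxE.
Unshelve. all: by end_near. Qed.

Lemma gram_inv_smooth u p i j : A u -> dom u p ->
  smooth_at A p (fun q => invmx (gram A g u q) i j).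
Proof.
move=> Au up; apply: (smooth_at_invmx hA) => [k l|].
  exact: gram_smooth.
by apply: filterS (near_dom (atlas_chart hA Au) up) => q; exact: gram_unit.
Qed.

Lemma metric_inj p X Y : tangent A p X -> tangent A p Y ->
  (forall Z, tangent A p Z -> g p X Z = g p Y Z) -> X = Y.
Proof.
have [u Au up] := atlas_cover hA p.
move=> tX tY e; rewrite (tangent_chartE hA Au up tX) (tangent_chartE hA Au up tY).
congr chart_tvec; rewrite -[LHS](mulmxK (gram_unit Au up)).
rewrite -[RHS](mulmxK (gram_unit Au up)); congr (_ *m _).
by apply/rowP => j; rewrite -!metric_frame// e//; exact: frame_tangent.
Qed.

(** Raising an index: in row conventions the differential of [phi] is multiplied on the right by the
    inverse Gram matrix. *)
Lemma riesz u p phi (X := chart_tvec A u p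
    ((\row_i frame A u i p phi) *m invmx (gram A g u p))) :
  A u -> dom u p ->
  tangent A p X /\ forall Y, tangent A p Y -> g p X Y = Y phi.
Proof.
move=> Au up; have tX : tangent A p X by exact: chart_tvec_tangent.
split=> // Y tY; rewrite (metric_gram Au up)// (tcoord_chart_tvec hA)//.
rewrite mulmxKV; last exact: gram_unit.
rewrite (tangent_sum_frame hA _ Au up tY) mxE; apply: eq_bigr => i _.
by rewrite !mxE mulrC.
Qed.

(** [riesz] provides an element of the set defining [grad], which rules out the default value of
    [xget]. *)
Lemma gradP p phi : tangent A p (grad A g phi p) /\
  forall Y, tangent A p Y -> g p (grad A g phi p) Y = Y phi.
Proof.
rewrite /grad; case: xgetP => [X -> //|].
have [u Au up] := atlas_cover hA p.
by move/(_ (chart_tvec A u p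
  ((\row_i frame A u i p phi) *m invmx (gram A g u p)))); case; exact: riesz.
Qed.

Lemma grad_tangent p phi : tangent A p (grad A g phi p).
Proof. by case: (gradP p phi). Qed.

Lemma metric_grad p phi Y : tangent A p Y -> g p (grad A g phi p) Y = Y phi.
Proof. by case: (gradP p phi) => _; apply. Qed.

Lemma grad_unique p phi X : tangent A p X ->
  (forall Y, tangent A p Y -> g p X Y = Y phi) -> X = grad A g phi p.
Proof.
move=> tX e; apply: (metric_inj tX (grad_tangent p phi)) => Z tZ.
by rewrite e// metric_grad.
Qed.

(** Both sides are the inner product of the two gradients. *)
Lemma grad_sym p phi f : grad A g phi p f = grad A g f p phi.
Proof.
rewrite -(metric_grad f (grad_tangent p phi)) -(metric_grad phi (grad_tangent p f)).
by apply: (Defs.metric_sym hg); exact: grad_tangent.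
Qed.

Lemma norm_grad p f : norm g p (grad A g f p) ^+ 2 = grad A g f p f.
Proof.
rewrite /norm sqr_sqrtr; last exact/metric_ge0/grad_tangent.
exact/metric_grad/grad_tangent.
Qed.

Lemma grad_self_ge0 p f : 0 <= grad A g f p f.
Proof. by rewrite -norm_grad sqr_ge0. Qed.

Lemma tcoord_grad u p phi : A u -> dom u p ->
  tcoord u (grad A g phi p) =
  (\row_i frame A u i p phi) *m invmx (gram A g u p).
Proof.
move=> Au up; have [tX eX] := riesz phi Au up.
by rewrite -(grad_unique tX eX) (tcoord_chart_tvec hA).
Qed.

Lemma grad_smooth p phi : smooth_at A p phi -> smooth_field_at A p (grad A g phi).
Proof.
move=> s; have [u Au up] := atlas_cover hA p.
apply: (smooth_field_intro hA Au up) => [|i].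
  by near=> q; exact: grad_tangent.
apply: (@smooth_at_ext _ _ _ _ hA _ (fun q =>
    ((\row_i frame A u i q phi) *m invmx (gram A g u q)) 0 i)).
  near=> q; rewrite -tcoord_grad//; first by rewrite mxE.
  by near: q; exact: near_dom (atlas_chart hA Au) up.
apply: smooth_at_mulmx => k j; last exact: gram_inv_smooth.
apply: (smooth_at_ext hA _ (smooth_at_frame hA j Au up s)).
by near=> q; rewrite mxE.
Unshelve. all: by end_near. Qed.

End Metric.

Section Divergence.
Context {R : realType} {M : topologicalType} {n : nat}.
Variables (A : set (chart R M n)) (g : tensor2 R M).
Hypotheses (hA : smooth_atlas A) (hg : riemannian_metric A g).
Hypothesis hL : levi_civita A g (levi_civita_connection A g).
Implicit Types (u : chart R M n) (p q : M) (phi f : M -> R).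
Let nabla := levi_civita_connection A g.

(* The matrix N of nabla Z in the coordinate frame splits as N = P + B, where P
   collects the covariant derivatives of the frame along Z and B the derivatives
   of the components of Z (no torsion), and Z(G) = P G + (P G)^T for the Gram
   matrix G (compatibility with the metric); hence tr P = tr (G^-1 Z(G)) / 2. *)
Lemma divergence u p (Z : vfield R M) : A u -> dom u p -> smooth_field_at A p Z ->
  \sum_i nabla p (frame A u i p) Z (xcoord u i) =
  \sum_i frame A u i p (fun q => Z q (xcoord u i)) +
  \tr (invmx (gram A g u p) *m
       \matrix_(i, j) Z p (fun q => gram A g u q i j)) / 2.
Proof.
move=> Au up sZ; have tZ := smooth_field_tangent sZ.
have sf i := frame_smooth hA i Au up.
pose P : 'M[R]_n := \matrix_(i, k) nabla p (Z p) (frame A u i) (xcoord u k).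
have tN i : tangent A p (nabla p (Z p) (frame A u i)) by exact: (lc_tangent hL).
have -> : \sum_i nabla p (frame A u i p) Z (xcoord u i) =
    \tr P + \sum_i frame A u i p (fun q => Z q (xcoord u i)).
  rewrite -big_split/=; apply: eq_bigr => i _; rewrite mxE.
  have := lc_torsion_free hL (sf i) sZ (smooth_at_xcoord hA i Au up).
  rewrite (_ : Z p (fun q => frame A u i q (xcoord u i)) = 0).
    by rewrite subr0 => <-; rewrite addrC subrK.
  rewrite (@tangent_near _ _ _ _ hA _ _ _ (fun=> 1) tZ); first exact: tangent_cst tZ.
  apply: filterS (near_dom (atlas_chart hA Au) up) => q uq.
  by rewrite (frame_xcoord hA)// eqxx.
rewrite addrC; congr (_ + _).
set G := gram A g u p.
have PG i j : g p (nabla p (Z p) (frame A u i)) (frame A u j p) = (P *m G) i j.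
  rewrite (metric_frame hA hg _ Au up (tN i)) !mxE.
  by apply: eq_bigr => k _; rewrite !mxE.
have -> : \matrix_(i, j) Z p (fun q => gram A g u q i j) = P *m G + (P *m G)^T.
  apply/matrixP => i j; rewrite [LHS]mxE [RHS]mxE [(P *m G)^T i j]mxE.
  rewrite -!PG.
  rewrite (_ : (fun q => gram A g u q i j) =
    (fun q => g q (frame A u i q) (frame A u j q))).
    rewrite (lc_metric hL tZ (sf i) (sf j)); congr (_ + _).
    by rewrite (Defs.metric_sym hg (frame_tangent i Au up) (tN j)).
  by rewrite funeqE => q; rewrite mxE.
have uG : G \in unitmx by exact: gram_unit.
rewrite trmx_mul (gram_tr hg Au up) mulmxDr raddfD/= mulKmx//.
have -> : \tr (invmx G *m (P *m G)) = \tr P by rewrite mxtrace_mulC mulmxK.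
by rewrite mxtrace_tr mulrDl -splitr.
Qed.

Lemma laplacianE u p phi : A u -> dom u p -> smooth_at A p phi ->
  laplacian A g phi p =
  \sum_i frame A u i p (fun q => grad A g phi q (xcoord u i)) +
  \tr (invmx (gram A g u p) *m
       \matrix_(i, j) grad A g phi p (fun q => gram A g u q i j)) / 2.
Proof.
move=> Au up s; have sg := grad_smooth hA hg s.
rewrite -(divergence Au up sg) /laplacian; apply: (tangent_traceE hA) => //.
  by move=> X tX; exact: (lc_tangent hL).
by move=> a X Y tX tY; exact: (lc_linear hL).
Qed.

(** Put W = grad f and V = grad phi. Pairing with W evaluates nabla_W V on [f]; vanishing torsion
    replaces it by nabla_V W plus a bracket, and compatibility with the metric gives g(nabla_V W, W)
    = V(|W|^2) / 2. *)
Lemma hessian_grad p phi f : smooth_at A p phi -> smooth_at A p f ->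
  hessian A g phi p (grad A g f p) (grad A g f p) =
  grad A g f p (fun q => grad A g f q phi)
  - grad A g phi p (fun q => grad A g f q f) / 2.
Proof.
move=> sphi sf; have sW := grad_smooth hA hg sf; have sV := grad_smooth hA hg sphi.
have tW := smooth_field_tangent sW; have tV := smooth_field_tangent sV.
rewrite /hessian -/nabla.
have tWV : tangent A p (nabla p (grad A g f p) (grad A g phi)).
  exact: (lc_tangent hL).
have tVW : tangent A p (nabla p (grad A g phi p) (grad A g f)).
  exact: (lc_tangent hL).
rewrite (Defs.metric_sym hg tWV tW) (metric_grad hA hg)//.
have := lc_torsion_free hL sV sW sf; rewrite -/nabla.
have := lc_metric hL tV sW sW; rewrite -/nabla.
rewrite (Defs.metric_sym hg tVW tW) !(metric_grad hA hg)//.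
rewrite (_ : (fun q => g q _ _) = (fun q => grad A g f q f)); last first.
  by rewrite funeqE => q; rewrite (metric_grad hA hg)//; exact: (grad_tangent hA hg).
rewrite (_ : (fun q => grad A g phi q f) = (fun q => grad A g f q phi)); last first.
  by rewrite funeqE => q; exact: (grad_sym hA hg).
by lra.
Qed.

End Divergence.

(** * Existence of the Levi-Civita connection *)

Definition dmx (R : realType) (M : topologicalType) k l (X : tvec R M)
  (B : M -> 'M[R]_(k, l)) : 'M[R]_(k, l) := \matrix_(i, j) X (fun q => B q i j).

Definition bil (R : realType) n (G : 'M[R]_n) (a b : 'rV[R]_n) : R :=
  (a *m G *m b^T) 0 0.

Section Bilinear.
Context {R : realType} {n : nat}.
Implicit Types (G : 'M[R]_n) (a b : 'rV[R]_n).

Lemma bil_sym G a b : G^T = G -> bil G a b = bil G b a.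
Proof.
move=> GT; rewrite /bil -[a *m G *m b^T]trmxK mxE trmx_mul trmxK trmx_mul GT.
by rewrite mulmxA.
Qed.

Lemma bilDl G a a' b : bil G (a + a') b = bil G a b + bil G a' b.
Proof. by rewrite /bil !mulmxDl mxE. Qed.

Lemma bilZl G (s : R) a b : bil G (s *: a) b = s * bil G a b.
Proof. by rewrite /bil -!scalemxAl mxE. Qed.

Lemma bilBl G a a' b : bil G (a - a') b = bil G a b - bil G a' b.
Proof. by rewrite -scaleN1r bilDl bilZl mulN1r. Qed.

Lemma bilDm G G' a b : bil (G + G') a b = bil G a b + bil G' a b.
Proof. by rewrite /bil mulmxDr mulmxDl mxE. Qed.

Lemma bilZm G (s : R) a b : bil (s *: G) a b = s * bil G a b.
Proof. by rewrite /bil -scalemxAr -scalemxAl mxE. Qed.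

End Bilinear.

Section MatrixDerivation.
Context {R : realType} {M : topologicalType} {n : nat}.
Variable A : set (chart R M n).
Hypothesis hA : smooth_atlas A.

Lemma dmx_mul p X k l m (B : M -> 'M[R]_(k, l)) (C : M -> 'M[R]_(l, m)) :
  tangent A p X ->
  (forall i j, smooth_at A p (fun q => B q i j)) ->
  (forall i j, smooth_at A p (fun q => C q i j)) ->
  dmx X (fun q => B q *m C q) = dmx X B *m C p + B p *m dmx X C.
Proof.
move=> tX sB sC; apply/matrixP => i j; rewrite !mxE.
under eq_fun do rewrite mxE.
rewrite (tangent_sum _ tX); last by move=> s _; exact: smooth_atM.
rewrite -big_split/=; apply: eq_bigr => s _.
by rewrite (tangentM hA tX) // !mxE.
Qed.

Lemma dmx_lin (X Y : tvec R M) (a : R) k l (B : M -> 'M[R]_(k, l)) :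
  dmx (fun phi => a * X phi + Y phi) B = a *: dmx X B + dmx Y B.
Proof. by apply/matrixP => i j; rewrite !mxE. Qed.

Lemma dmx_sum_frame u p X k l (B : M -> 'M[R]_(k, l)) : A u -> dom u p ->
  tangent A p X ->
  dmx X B = \sum_i tcoord u X 0 i *: dmx (frame A u i p) B.
Proof.
move=> Au up tX; apply/matrixP => i j; rewrite !mxE summxE.
rewrite (tangent_sum_frame hA _ Au up tX).
by apply: eq_bigr => s _; rewrite !mxE.
Qed.

Lemma smooth_at_tcoord u p Z i j : A u -> dom u p -> smooth_field_at A p Z ->
  smooth_at A p (fun q => tcoord u (Z q) i j).
Proof.
move=> Au up sZ; under eq_fun do rewrite mxE.
exact: (smooth_field_apply sZ (smooth_at_xcoord hA j Au up)).
Qed.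

Lemma smooth_fieldD p (Y Z : vfield R M) : smooth_field_at A p Y ->
  smooth_field_at A p Z -> smooth_field_at A p (fun q phi => Y q phi + Z q phi).
Proof.
move=> [tY sY] [tZ sZ]; split=> [|phi s]; last by apply: smooth_atD; [exact: sY|exact: sZ].
near=> q; have tYq : tangent A q (Y q) by near: q.
have tZq : tangent A q (Z q) by near: q.
have := tangent_lin hA 1 tYq tZq.
by congr tangent; rewrite funeqE => phi; rewrite mul1r.
Unshelve. all: by end_near. Qed.

Lemma smooth_fieldM p phi (Z : vfield R M) : smooth_at A p phi ->
  smooth_field_at A p Z -> smooth_field_at A p (fun q psi => phi q * Z q psi).
Proof.
move=> s [tZ sZ]; split=> [|psi spsi]; last by apply: smooth_atM; [|exact: sZ].
near=> q; have tZq : tangent A q (Z q) by near: q.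
have := tangent_lin hA (phi q) tZq (tangent0 hA q).
by congr tangent; rewrite funeqE => psi; rewrite addr0.
Unshelve. all: by end_near. Qed.

Lemma chart_tvec_lin u p (s : R) (a b : 'rV[R]_n) : A u -> dom u p ->
  chart_tvec A u p (s *: a + b) =
  fun phi => s * chart_tvec A u p a phi + chart_tvec A u p b phi.
Proof.
move=> Au up; rewrite funeqE => phi; rewrite !chart_tvec_sum//.
rewrite mulr_sumr -big_split/=; apply: eq_bigr => i _.
by rewrite !mxE; ring.
Qed.

End MatrixDerivation.

Section LeviCivitaExists.
Context {R : realType} {M : topologicalType} {n : nat}.
Variables (A : set (chart R M n)) (g : tensor2 R M).
Hypotheses (hA : smooth_atlas A) (hg : riemannian_metric A g).
Implicit Types (u : chart R M n) (p q : M) (X T : tvec R M) (Y Z W : vfield R M).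

Let dcoord u X Z : 'rV[R]_n := dmx X (fun q => tcoord u (Z q)).
Let dgram u X : 'M[R]_n := dmx X (gram A g u).

(* Christoffel symbols of the first kind, contracted with two tangent vectors *)
Let christoffel u p X T : 'rV[R]_n :=
  \row_k ((bil (dgram u X) (tcoord u T) (delta_mx 0 k)
           + bil (dgram u T) (tcoord u X) (delta_mx 0 k)
           - bil (dgram u (frame A u k p)) (tcoord u X) (tcoord u T)) / 2).

(** The covariant derivative as seen in one chart: derivatives of the components plus the
    Christoffel term with its index raised. *)
Let cov u p X Z : tvec R M := chart_tvec A u p
  (dcoord u X Z + christoffel u p X (Z p) *m invmx (gram A g u p)).

(** The guard makes the bracket vanish on functions that are not smooth near [p], as tangent vectors
    do. *)
Let bracket p Y Z : tvec R M := fun phi => if `[< smooth_at A p phi >]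
  then Y p (fun q => Z q phi) - Z p (fun q => Y q phi) else 0.

(** Koszul's expression for twice the inner product of nabla_V Z with Y. *)
Let koszul p (V Z Y : vfield R M) :=
  V p (fun q => g q (Z q) (Y q)) + Z p (fun q => g q (V q) (Y q))
  - Y p (fun q => g q (V q) (Z q)) + g p (bracket p V Z) (Y p)
  - g p (bracket p V Y) (Z p) - g p (bracket p Z Y) (V p).

(* Koszul's formula determines the covariant derivative without reference to a
   chart. *)
Let levi : connection R M := fun p X Z => xget (fun=> 0)
  [set T | tangent A p T /\ forall V Y, smooth_field_at A p V ->
     smooth_field_at A p Y -> V p = X -> 2 * g p T (Y p) = koszul p V Z Y].

Let dgram_tr u p X : A u -> dom u p -> tangent A p X -> (dgram u X)^T = dgram u X.
Proof.
move=> Au up tX; apply/matrixP => i j; rewrite !mxE.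
apply: (tangent_near hA tX).
apply: filterS (near_dom (atlas_chart hA Au) up) => q uq.
by rewrite -[in LHS](gram_tr hg Au uq) mxE.
Qed.

Let bracket_chart u p Y Z : A u -> dom u p -> smooth_field_at A p Y ->
  smooth_field_at A p Z ->
  bracket p Y Z = chart_tvec A u p (dcoord u (Y p) Z - dcoord u (Z p) Y).
Proof.
move=> Au up sY sZ; rewrite funeqE => phi.
case: (pselect (smooth_at A p phi)) => [s|ns]; last first.
  by rewrite /bracket /chart_tvec !asboolF.
rewrite /bracket asboolT// (bracketE hA Au up sY sZ s) chart_tvec_sum//.
apply: eq_bigr => k _; congr (_ * _); rewrite !mxE.
have tE (W : vfield R M) : (fun q => tcoord u (W q) 0 k) = (fun q => W q (xcoord u k)).
  by rewrite funeqE => q; rewrite mxE.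
by rewrite !tE.
Qed.

Let derive_metric u p X Y Z : A u -> dom u p -> tangent A p X ->
  smooth_field_at A p Y -> smooth_field_at A p Z ->
  X (fun q => g q (Y q) (Z q)) =
  bil (gram A g u p) (dcoord u X Y) (tcoord u (Z p))
  + bil (dgram u X) (tcoord u (Y p)) (tcoord u (Z p))
  + bil (gram A g u p) (tcoord u (Y p)) (dcoord u X Z).
Proof.
move=> Au up tX sY sZ.
have sYc := smooth_at_tcoord hA _ _ Au up sY.
have sZc := smooth_at_tcoord hA _ _ Au up sZ.
have sG i j := gram_smooth hA hg i j Au up.
transitivity (dmx X (fun q =>
    tcoord u (Y q) *m gram A g u q *m (tcoord u (Z q))^T) 0 0).
  rewrite mxE; apply: (tangent_near hA tX); near=> q.
  apply: (metric_gram hA hg Au).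
  - by near: q; exact: near_dom (atlas_chart hA Au) up.
  - by near: q; case: sY.
  - by near: q; case: sZ.
rewrite (dmx_mul hA tX); last 2 first.
- by apply: smooth_at_mulmx.
- by move=> i j; under eq_fun do rewrite mxE; exact: sZc.
have -> : dmx X (fun q => (tcoord u (Z q))^T) = (dcoord u X Z)^T.
  apply/matrixP => i j; rewrite !mxE.
  by congr X; rewrite funeqE => q; rewrite mxE.
by rewrite (dmx_mul hA tX)// mulmxDl [LHS]mxE [X in X + _]mxE.
Unshelve. all: by end_near. Qed.

(** Pairing with [T] lowers the index, so the inverse Gram matrix cancels and the Christoffel
    symbols of the first kind are summed against the components of [T]. *)
Let metric_cov u p X Z T : A u -> dom u p -> tangent A p X -> tangent A p T ->
  smooth_field_at A p Z ->
  g p (cov u p X Z) T = bil (gram A g u p) (dcoord u X Z) (tcoord u T) +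
    (bil (dgram u X) (tcoord u (Z p)) (tcoord u T)
     + bil (dgram u (Z p)) (tcoord u X) (tcoord u T)
     - bil (dgram u T) (tcoord u X) (tcoord u (Z p))) / 2.
Proof.
move=> Au up tX tT sZ.
have tcov : tangent A p (cov u p X Z) by exact: chart_tvec_tangent.
rewrite (metric_gram hA hg Au up tcov tT) (tcoord_chart_tvec hA)// -/(bil _ _ _).
rewrite bilDl; congr (_ + _).
rewrite /bil mulmxKV; last exact: gram_unit.
rewrite -!/(bil _ _ _) mxE.
under eq_bigr => k _ do rewrite !mxE mulrAC.
rewrite -mulr_suml; congr (_ / 2).
have bsum (G : 'M[R]_n) (a : 'rV[R]_n) :
    bil G a (tcoord u T) = \sum_k bil G a (delta_mx 0 k) * T (xcoord u k).
  rewrite /bil mxE; apply: eq_bigr => k _.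
  by rewrite trmx_delta -colE !mxE.
rewrite !bsum [dgram u T](dmx_sum_frame hA _ Au up tT).
have -> : bil (\sum_i tcoord u T 0 i *: dmx (frame A u i p) (gram A g u))
    (tcoord u X) (tcoord u (Z p)) =
  \sum_k bil (dgram u (frame A u k p)) (tcoord u X) (tcoord u (Z p)) * T (xcoord u k).
  rewrite /bil mulmx_sumr mulmx_suml summxE; apply: eq_bigr => k _.
  by rewrite -scalemxAr -scalemxAl !mxE mulrC.
rewrite -big_split -sumrB/=; apply: eq_bigr => k _.
by ring.
Qed.

(** Derivatives of components cancel between the metric terms and the bracket terms, except those of
    [Z] along [X], which occur twice; what is left is the Christoffel combination. *)
Let koszulE u p (X Z Y : vfield R M) : A u -> dom u p -> smooth_field_at A p X ->
  smooth_field_at A p Z -> smooth_field_at A p Y ->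
  2 * g p (cov u p (X p) Z) (Y p) = koszul p X Z Y.
Proof.
move=> Au up sX sZ sY.
have tX := smooth_field_tangent sX; have tY := smooth_field_tangent sY.
have tZ := smooth_field_tangent sZ.
have tb V W : smooth_field_at A p V -> smooth_field_at A p W ->
    tangent A p (bracket p V W).
  by move=> sV sW; rewrite (bracket_chart Au up sV sW); exact: chart_tvec_tangent.
have gb V W T : smooth_field_at A p V -> smooth_field_at A p W -> tangent A p T ->
    g p (bracket p V W) T =
    bil (gram A g u p) (dcoord u (V p) W) (tcoord u T) -
    bil (gram A g u p) (dcoord u (W p) V) (tcoord u T).
  move=> sV sW tT; rewrite (metric_gram hA hg Au up (tb _ _ sV sW) tT).
  by rewrite (bracket_chart Au up sV sW) (tcoord_chart_tvec hA)// -bilBl.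
have gT := gram_tr hg Au up.
rewrite (metric_cov Au up tX tY sZ) /koszul !gb// !(derive_metric Au up)//.
rewrite (bil_sym (tcoord u (Z p)) (dcoord u (X p) Y) gT).
rewrite (bil_sym (tcoord u (X p)) (dcoord u (Z p) Y) gT).
rewrite (bil_sym (tcoord u (X p)) (dcoord u (Y p) Z) gT).
by field.
Qed.

(** Nondegeneracy of [g] makes a solution of Koszul's formula unique, and [koszulE] shows that [cov]
    is one; hence [levi] can be computed in any chart around [p]. *)
Let leviE u p X Z : A u -> dom u p -> tangent A p X -> smooth_field_at A p Z ->
  levi p X Z = cov u p X Z.
Proof.
move=> Au up tX sZ; rewrite /levi; case: xgetP => [T -> [tT TK]|].
  apply: (metric_inj hA hg tT); first exact: chart_tvec_tangent.
  (* Koszul's formula speaks of fields, so [X] and the test vector [S] are extended with constant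
     coordinates. *)
  move=> S tS; pose V q := chart_tvec A u q (tcoord u X).
  pose Y q := chart_tvec A u q (tcoord u S).
  have sV : smooth_field_at A p V.
    by apply: (smooth_field_chart hA Au up) => i; exact: smooth_at_cst.
  have sY : smooth_field_at A p Y.
    by apply: (smooth_field_chart hA Au up) => i; exact: smooth_at_cst.
  have VX : V p = X by rewrite /V -(tangent_chartE hA Au up tX).
  have YS : Y p = S by rewrite /Y -(tangent_chartE hA Au up tS).
  have two0 : (2 : R) != 0 by rewrite pnatr_eq0.
  by apply: (mulfI two0); rewrite -YS (TK V)// -VX koszulE.
move/(_ (cov u p X Z)); case; split; first exact: chart_tvec_tangent.
by move=> V Y sV sY <-; exact: koszulE.
Qed.

(** This symmetry accounts for the absence of torsion, and it carries [christoffel_lin] over to the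
    other argument. *)
Let christoffelC u p X T : A u -> dom u p -> tangent A p X -> tangent A p T ->
  christoffel u p X T = christoffel u p T X.
Proof.
move=> Au up tX tT; apply/rowP => k; rewrite !mxE.
have tf := frame_tangent k Au up.
by rewrite (bil_sym (tcoord u X) (tcoord u T) (dgram_tr Au up tf)); ring.
Qed.

Let christoffel_lin u p (a : R) X X' T :
  christoffel u p (fun phi => a * X phi + X' phi) T =
  a *: christoffel u p X T + christoffel u p X' T.
Proof.
have tl : tcoord u (fun phi => a * X phi + X' phi) = a *: tcoord u X + tcoord u X'.
  by apply/rowP => k; rewrite !mxE.
apply/rowP => k; rewrite !mxE tl /dgram dmx_lin !bilDm !bilDl !bilZm !bilZl.
by field.
Qed.

(** Each axiom concerns one point and its neighbourhood, so [leviE] turns it into a computation with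
    [cov] in a single chart. *)
Lemma exists_levi_civita : exists nabla, levi_civita A g nabla.
Proof.
exists levi; split.
- move=> p X Z tX sZ; have [u Au up] := atlas_cover hA p.
  by rewrite (leviE Au up tX sZ); exact: chart_tvec_tangent.
- move=> p Y Z sY sZ; have [u Au up] := atlas_cover hA p.
  have sYn := smooth_field_near hA sY; have sZn := smooth_field_near hA sZ.
  have dn := near_dom (atlas_chart hA Au) up.
  have sf k := frame_smooth hA k Au up.
  have sG k l := gram_smooth hA hg k l Au up.
  (* The chart [u] stays fixed while the point moves, so smoothness can be read off the coordinate
     expression. *)
  apply: (@smooth_field_near_ext _ _ _ _ hA _ (fun q => chart_tvec A u q
    (dcoord u (Y q) Z + christoffel u q (Y q) (Z q) *m invmx (gram A g u q)))).
    near=> q; apply: esym; apply: leviE => //.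
    + by near: q.
    + by near: q; case: sY.
    + by near: q.
  apply: (smooth_field_chart hA Au up) => i; under eq_fun do rewrite mxE.
  have sbil (W V V' : vfield R M) : smooth_field_at A p W ->
      smooth_field_at A p V -> smooth_field_at A p V' ->
      smooth_at A p (fun q => bil (dgram u (W q)) (tcoord u (V q)) (tcoord u (V' q))).
    move=> sW sV sV'; apply: smooth_at_mulmx => k l.
      apply: smooth_at_mulmx => k' l'; first exact: (smooth_at_tcoord hA).
      under eq_fun do rewrite mxE.
      exact: (smooth_field_apply sW).
    under eq_fun do rewrite mxE.
    exact: (smooth_at_tcoord hA).
  have sbilf (W V : vfield R M) k : smooth_field_at A p W ->
      smooth_field_at A p V ->
      smooth_at A p (fun q => bil (dgram u (W q)) (tcoord u (V q)) (delta_mx 0 k)).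
    move=> sW sV; apply: smooth_at_mulmx => k' l.
      apply: smooth_at_mulmx => k'' l'; first exact: (smooth_at_tcoord hA).
      under eq_fun do rewrite mxE.
      exact: (smooth_field_apply sW).
    exact: smooth_at_cst.
  apply: smooth_atD.
    under eq_fun do rewrite mxE.
    apply: (smooth_field_apply sY).
    exact: (smooth_at_tcoord hA).
  apply: smooth_at_mulmx => k l; last exact: gram_inv_smooth.
  under eq_fun do rewrite mxE.
  apply: smooth_atM; last exact: smooth_at_cst.
  apply: (smooth_atB hA); last exact: sbil.
  by apply: smooth_atD; exact: sbilf.
- move=> p a X Y Z tX tY sZ; have [u Au up] := atlas_cover hA p.
  rewrite !(leviE Au up)//; last exact: (tangent_lin hA).
  rewrite /cov -chart_tvec_lin//; congr chart_tvec.
  rewrite /dcoord dmx_lin christoffel_lin mulmxDl -scalemxAl scalerDr.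
  by rewrite addrACA.
- move=> p X Y Z tX sY sZ; have [u Au up] := atlas_cover hA p.
  have tY := smooth_field_tangent sY; have tZ := smooth_field_tangent sZ.
  have sYZ := smooth_fieldD hA sY sZ.
  rewrite !(leviE Au up)//.
  transitivity (fun phi => 1 * cov u p X Y phi + cov u p X Z phi); last first.
    by rewrite funeqE => phi; rewrite mul1r.
  rewrite /cov -chart_tvec_lin//; congr chart_tvec.
  have -> : dcoord u X (fun q phi => Y q phi + Z q phi) = dcoord u X Y + dcoord u X Z.
    apply/matrixP => i k; rewrite !mxE.
    have := tangentD tX (smooth_at_tcoord hA i k Au up sY)
      (smooth_at_tcoord hA i k Au up sZ).
    by move=> <-; congr X; rewrite funeqE => q; rewrite !mxE.
  have tYZ := smooth_field_tangent sYZ.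
  rewrite (christoffelC Au up tX tYZ).
  rewrite (_ : (fun phi => Y p phi + Z p phi) = (fun phi => 1 * Y p phi + Z p phi)).
    rewrite christoffel_lin !scale1r mulmxDl addrACA.
    by rewrite (christoffelC Au up tX tY) (christoffelC Au up tX tZ).
  by rewrite funeqE => phi; rewrite mul1r.
- move=> p X phi Z tX s sZ; have [u Au up] := atlas_cover hA p.
  have tZ := smooth_field_tangent sZ; have sM := smooth_fieldM hA s sZ.
  have tM := smooth_field_tangent sM.
  rewrite !(leviE Au up)//.
  transitivity (fun psi => phi p * cov u p X Z psi +
      chart_tvec A u p (X phi *: tcoord u (Z p)) psi); last first.
    rewrite funeqE => psi; rewrite addrC; congr (_ + _).
    rewrite chart_tvec_sum// (tangent_sum_frame hA _ Au up tZ) mulr_sumr.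
    by apply: eq_bigr => i _; rewrite !mxE mulrA.
  rewrite /cov -chart_tvec_lin//; congr chart_tvec.
  have -> : dcoord u X (fun q psi => phi q * Z q psi) =
      phi p *: dcoord u X Z + X phi *: tcoord u (Z p).
    apply/matrixP => i k; rewrite !mxE addrC.
    have := tangentM hA tX s (smooth_at_tcoord hA i k Au up sZ).
    rewrite mxE => <-.
    by congr X; rewrite funeqE => q; rewrite !mxE.
  rewrite (christoffelC Au up tX tM).
  rewrite (_ : (fun psi => phi p * Z p psi) = (fun psi => phi p * Z p psi + 0)).
    rewrite (christoffel_lin _ _ _ _ (fun=> 0)) (christoffelC Au up tX tZ).
    rewrite (_ : christoffel u p (fun=> 0) X = 0).
      by rewrite addr0 -scalemxAl scalerDr addrAC.
    (* Linearity with coefficient -1 at zero vectors forces the value 0. *)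
    have c0 := christoffel_lin u p (-1) (fun=> 0) (fun=> 0) X.
    rewrite scaleN1r addNr in c0; rewrite -[RHS]c0.
    by congr christoffel; rewrite funeqE => psi; rewrite mulr0 addr0.
  by rewrite funeqE => psi; rewrite addr0.
- move=> p Y Z phi sY sZ s; have [u Au up] := atlas_cover hA p.
  have tY := smooth_field_tangent sY; have tZ := smooth_field_tangent sZ.
  have := bracket_chart Au up sY sZ; move/(congr1 (fun T => T phi)).
  rewrite /bracket asboolT// => ->.
  (* The Christoffel terms agree by symmetry, so only the difference of coordinate derivatives, the
     bracket, survives. *)
  rewrite !(leviE Au up)// /cov (christoffelC Au up tY tZ) !chart_tvec_sum//.
  rewrite -sumrB; apply: eq_bigr => i _; rewrite -mulrBl; congr (_ * _).
  by rewrite !mxE; ring.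
- move=> p X Y Z tX sY sZ; have [u Au up] := atlas_cover hA p.
  have tY := smooth_field_tangent sY; have tZ := smooth_field_tangent sZ.
  rewrite !(leviE Au up)//.
  have tcov : tangent A p (cov u p X Z) by exact: chart_tvec_tangent.
  (* In the sum of the two pairings the derivatives of the Gram matrix along [Y p] and [Z p] cancel,
     and the two halves of its derivative along [X] add up. *)
  rewrite (Defs.metric_sym hg tY tcov) (metric_cov Au up tX tZ sY)
    (metric_cov Au up tX tY sZ).
  rewrite (derive_metric Au up)//.
  have gT := gram_tr hg Au up.
  rewrite (bil_sym (tcoord u (Y p)) (dcoord u X Z) gT).
  rewrite (bil_sym (tcoord u (Z p)) (tcoord u (Y p)) (dgram_tr Au up tX)).
  by field.
Unshelve. all: by end_near. Qed.

Lemma levi_civita_connectionP :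
  levi_civita A g (levi_civita_connection A g).
Proof.
rewrite /levi_civita_connection; case: xgetP => [nabla -> //|].
by have [nabla hn] := exists_levi_civita => /(_ nabla).
Qed.

End LeviCivitaExists.

(** * Products of manifolds *)

Lemma continuous_row (R : realType) (M : topologicalType) n
    (F : M -> 'rV[R]_n) (p : M) :
  (forall j, {for p, continuous (fun q => F q 0 j)}) -> {for p, continuous F}.
Proof.
move=> cF B [P hP sPB]; apply: (@filterS _ (nbhs p) _
    [set q | forall i j, P i j (F q i j)]); first by move=> q Pq; exact: sPB.
apply: filter_forall => i; apply: filter_forall => j.
by rewrite ord1; apply: (cF j); have := hP 0 j; apply.
Qed.

Lemma continuous_coord_comp (R : realType) (M : topologicalType) n
    (F : M -> 'rV[R]_n) (p : M) j :
  {for p, continuous F} -> {for p, continuous (fun q => F q 0 j)}.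
Proof.
move=> cF; apply: (@continuous_comp _ _ _ F (fun x : 'rV[R]_n => x 0 j)) => //.
exact: coord_continuous.
Qed.

Section ProductAtlas.
Context {R : realType} {M1 M2 : topologicalType} {n1 n2 : nat}.

Lemma prod_chart_is_chart (u1 : chart R M1 n1) (u2 : chart R M2 n2) :
  is_chart u1 -> is_chart u2 -> is_chart (prod_chart u1 u2).
Proof.
move=> h1 h2.
have imgE : cmap (prod_chart u1 u2) @` dom (prod_chart u1 u2) =
    [set x | (cmap u1 @` dom u1) (lsubmx x)] `&`
    [set x | (cmap u2 @` dom u2) (rsubmx x)].
  rewrite eqEsubset; split=> [_ [[q1 q2] [/= q1d q2d] <-]|x [[q1 q1d e1] [q2 q2d e2]]].
    by split; rewrite /= ?row_mxKl ?row_mxKr; [exists q1|exists q2].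
  by exists (q1, q2) => //=; rewrite e1 e2 hsubmxK.
split.
- rewrite (_ : dom _ = fst @^-1` dom u1 `&` snd @^-1` dom u2) //.
  apply: openI; apply: open_comp; try exact: chart_open_dom.
    by move=> p _; exact: cvg_fst.
  by move=> p _; exact: cvg_snd.
- rewrite imgE; apply: openI; apply: open_comp; try exact: chart_open_img.
    by move=> x _; exact: continuous_lsubmx.
  by move=> x _; exact: continuous_rsubmx.
- move=> [p1 p2] [/= d1 d2]; rewrite row_mxKl row_mxKr.
  by rewrite (chart_cancel h1) ?(chart_cancel h2).
- move=> [p1 p2] [/= d1 d2]; apply: continuous_row => j.
  case: (split_ordP j) => k ->.
    under [X in {for _, continuous X}]eq_fun do rewrite /= row_mxEl.
    apply: (@continuous_coord_comp _ _ _ (cmap u1 \o fst)).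
    apply: continuous_comp; first exact: cvg_fst.
    exact: chart_cont.
  under [X in {for _, continuous X}]eq_fun do rewrite /= row_mxEr.
  apply: (@continuous_coord_comp _ _ _ (cmap u2 \o snd)).
  apply: continuous_comp; first exact: cvg_snd.
  exact: chart_cont.
- move=> x; rewrite imgE => -[x1 x2].
  have c1 : {for x, continuous (fun y : 'rV[R]_(n1 + n2) => cinv u1 (lsubmx y))}.
    apply: (@continuous_comp _ _ _ (lsubmx : _ -> 'rV[R]_n1) (cinv u1)).
      exact: continuous_lsubmx.
    exact: chart_inv_cont.
  have c2 : {for x, continuous (fun y : 'rV[R]_(n1 + n2) => cinv u2 (rsubmx y))}.
    apply: (@continuous_comp _ _ _ (rsubmx : _ -> 'rV[R]_n2) (cinv u2)).
      exact: continuous_rsubmx.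
    exact: chart_inv_cont.
  exact: (cvg_pair c1 c2).
Qed.

Lemma prod_smooth_atlas (A1 : set (chart R M1 n1)) (A2 : set (chart R M2 n2)) :
  smooth_atlas A1 -> smooth_atlas A2 -> smooth_atlas (prod_atlas A1 A2).
Proof.
move=> hA1 hA2; split.
- move=> _ [u1 [u2 [A1u A2u ->]]].
  by exact: prod_chart_is_chart (atlas_chart hA1 A1u) (atlas_chart hA2 A2u).
- move=> [p1 p2]; have [u1 A1u d1] := atlas_cover hA1 p1.
  have [u2 A2u d2] := atlas_cover hA2 p2.
  by exists (prod_chart u1 u2) => //; exists u1, u2.
- move=> _ _ [u1 [u2 [A1u A2u ->]]] [v1 [v2 [A1v A2v ->]]] [p1 p2].
  move=> [/= du1 du2] [/= dv1 dv2] i; case: (split_ordP i) => k ->.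
    under [X in smooth_near X]eq_fun do rewrite /= row_mxEl.
    apply: (@smooth_near_comp _ _ _ lsubmx (fun x => cmap v1 (cinv u1 x) 0 k)).
      move=> j; under [X in smooth_near X]eq_fun do rewrite mxE.
      exact: smooth_near_coord.
    by rewrite row_mxKl; exact: (atlas_compatible hA1).
  under [X in smooth_near X]eq_fun do rewrite /= row_mxEr.
  apply: (@smooth_near_comp _ _ _ rsubmx (fun x => cmap v2 (cinv u2 x) 0 k)).
    move=> j; under [X in smooth_near X]eq_fun do rewrite mxE.
    exact: smooth_near_coord.
  by rewrite row_mxKr; exact: (atlas_compatible hA2).
Qed.

End ProductAtlas.

(* A map F which, in the charts w and u, keeps the coordinates of index iota j
   and forgets the others. *)
Section CoordinateProjection.
Context {R : realType} {M N : topologicalType} {n k : nat}.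
Variables (A : set (chart R M n)) (B : set (chart R N k)).
Hypotheses (hA : smooth_atlas A) (hB : smooth_atlas B).
Variables (w : chart R M n) (u : chart R N k) (iota : 'I_k -> 'I_n) (F : M -> N).
Hypotheses (Aw : A w) (Bu : B u).
Hypothesis F_dom : forall p, dom w p -> dom u (F p).
Hypothesis F_cmap : forall p, cmap u (F p) = \row_j cmap w p 0 (iota j).
Hypothesis F_cinv : forall x, F (cinv w x) = cinv u (\row_j x 0 (iota j)).
Implicit Types (p : M) (phi : N -> R) (X : tvec R M).

Let proj (x : 'rV[R]_n) : 'rV[R]_k := \row_j x 0 (iota j).

Let proj_coord (j : 'I_k) : (fun x => proj x 0 j) = (fun x => x 0 (iota j)).
Proof. by rewrite funeqE => x; rewrite mxE. Qed.

Let comp_cinv phi : (phi \o F) \o cinv w = (phi \o cinv u) \o proj.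
Proof. by rewrite funeqE => x /=; rewrite F_cinv. Qed.

Lemma smooth_at_comp_proj p phi : dom w p -> smooth_at B (F p) phi ->
  smooth_at A p (phi \o F).
Proof.
move=> wp s; apply/(smooth_at_chart hA _ Aw wp); rewrite comp_cinv.
apply: smooth_near_comp.
  by move=> j; rewrite proj_coord; exact: smooth_near_coord.
by rewrite /proj -F_cmap; apply: s => //; exact: F_dom.
Qed.

(** In the two charts [F] is a linear coordinate projection, hence its own differential. *)
Lemma pushforward_chart_tvec p (a : 'rV[R]_n) : dom w p ->
  Defs.pushforward B F p (chart_tvec A w p a) =
  chart_tvec B u (F p) (\row_j a 0 (iota j)).
Proof.
move=> wp; rewrite funeqE => phi; rewrite /Defs.pushforward.
case: (pselect (smooth_at B (F p) phi)) => [s|ns]; last first.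
  by rewrite /chart_tvec !(asboolF ns).
rewrite (asboolT s) chart_tvecE; last exact: smooth_at_comp_proj.
rewrite chart_tvecE// comp_cinv derive_comp_row.
- rewrite derive_row_sum.
    apply: eq_bigr => j _; rewrite proj_coord derive_coord mxE.
    by rewrite F_cmap.
  by apply: smooth_near_differentiable; apply: s => //; exact: F_dom.
- by move=> j; rewrite proj_coord; exact: differentiable_coord.
- rewrite /proj -F_cmap.
  by apply: smooth_near_differentiable; apply: s => //; exact: F_dom.
Qed.

Lemma pushforward_tangent p X : dom w p -> tangent A p X ->
  tangent B (F p) (Defs.pushforward B F p X).
Proof.
move=> wp tX; rewrite (tangent_chartE hA Aw wp tX) pushforward_chart_tvec//.
by apply: chart_tvec_tangent => //; exact: F_dom.
Qed.

Lemma tcoord_pushforward p X : dom w p -> tangent A p X ->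
  tcoord u (Defs.pushforward B F p X) = \row_j tcoord w X 0 (iota j).
Proof.
move=> wp tX; rewrite {1}(tangent_chartE hA Aw wp tX) pushforward_chart_tvec//.
by rewrite (tcoord_chart_tvec hB)//; exact: F_dom.
Qed.

Lemma pullback_smooth (g : tensor2 R N) p (X Y : vfield R M) : dom w p ->
  riemannian_metric B g -> smooth_field_at A p X -> smooth_field_at A p Y ->
  smooth_at A p (fun q => pullback B F g q (X q) (Y q)).
Proof.
move=> wp hg sX sY.
have wn := near_dom (atlas_chart hA Aw) wp.
apply: (@smooth_at_ext _ _ _ _ hA _ (fun q =>
  bil (gram B g u (F q)) (\row_j tcoord w (X q) 0 (iota j))
     (\row_j tcoord w (Y q) 0 (iota j)))).
  near=> q; have wq : dom w q by near: q.
  have tX : tangent A q (X q) by near: q; case: sX.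
  have tY : tangent A q (Y q) by near: q; case: sY.
  rewrite /pullback (metric_gram hB hg Bu (F_dom wq)) ?tcoord_pushforward//.
    exact: pushforward_tangent.
  exact: pushforward_tangent.
apply: smooth_at_mulmx => [i j|i j].
  apply: smooth_at_mulmx => [i' j'|i' j'].
    under eq_fun do rewrite mxE.
    exact: (smooth_at_tcoord hA).
  have sg := gram_smooth hB hg i' j' Bu (F_dom wp).
  exact: smooth_at_comp_proj sg.
under eq_fun do rewrite !mxE.
by have := smooth_at_tcoord hA 0 (iota i) Aw wp sY; under eq_fun do rewrite mxE.
Unshelve. all: by end_near. Qed.

End CoordinateProjection.

Section ProductTangent.
Context {R : realType} {M1 M2 : topologicalType} {n1 n2 : nat}.
Variables (A1 : set (chart R M1 n1)) (A2 : set (chart R M2 n2)).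
Hypotheses (hA1 : smooth_atlas A1) (hA2 : smooth_atlas A2).
Let A := prod_atlas A1 A2.
Implicit Types (p : M1 * M2) (X Y : tvec R (M1 * M2)%type).
Implicit Types (u : chart R M1 n1) (v : chart R M2 n2).

Let hA : smooth_atlas A. Proof. exact: prod_smooth_atlas. Qed.

Lemma prod_atlas_chart u v : A1 u -> A2 v -> A (prod_chart u v).
Proof. by exists u, v. Qed.

Let fst_cmap u v p : cmap u p.1 = \row_j cmap (prod_chart u v) p 0 (lshift n2 j).
Proof. by apply/rowP => j; rewrite mxE row_mxEl. Qed.

Let snd_cmap u v p : cmap v p.2 = \row_j cmap (prod_chart u v) p 0 (rshift n1 j).
Proof. by apply/rowP => j; rewrite mxE row_mxEr. Qed.

Let fst_cinv u v (x : 'rV[R]_(n1 + n2)) :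
  (cinv (prod_chart u v) x).1 = cinv u (\row_j x 0 (lshift n2 j)).
Proof. by congr cinv; apply/rowP => j; rewrite !mxE. Qed.

Let snd_cinv u v (x : 'rV[R]_(n1 + n2)) :
  (cinv (prod_chart u v) x).2 = cinv v (\row_j x 0 (rshift n1 j)).
Proof. by congr cinv; apply/rowP => j; rewrite !mxE. Qed.

Let fst_dom u v p : dom (prod_chart u v) p -> dom u p.1.
Proof. by case. Qed.

Let snd_dom u v p : dom (prod_chart u v) p -> dom v p.2.
Proof. by case. Qed.

Let prod_cover p : exists u v, [/\ A1 u, A2 v & dom (prod_chart u v) p].
Proof.
have [u A1u d1] := atlas_cover hA1 p.1; have [v A2v d2] := atlas_cover hA2 p.2.
by exists u, v.
Qed.

Lemma smooth_at_hlift p phi : smooth_at A1 p.1 phi -> smooth_at A p (hlift phi).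
Proof.
move=> s; have [u [v [A1u A2v d]]] := prod_cover p.
exact: (smooth_at_comp_proj hA (prod_atlas_chart A1u A2v) A1u (@fst_dom u v)
  (fst_cmap u v) (fst_cinv u v) d s).
Qed.

Lemma smooth_at_vlift p phi : smooth_at A2 p.2 phi -> smooth_at A p (vlift phi).
Proof.
move=> s; have [u [v [A1u A2v d]]] := prod_cover p.
exact: (smooth_at_comp_proj hA (prod_atlas_chart A1u A2v) A2v (@snd_dom u v)
  (snd_cmap u v) (snd_cinv u v) d s).
Qed.

Lemma pushforward_fst_tangent p X : tangent A p X ->
  tangent A1 p.1 (Defs.pushforward A1 fst p X).
Proof.
move=> tX; have [u [v [A1u A2v d]]] := prod_cover p.
exact: (pushforward_tangent hA (prod_atlas_chart A1u A2v) A1u (@fst_dom u v)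
  (fst_cmap u v) (fst_cinv u v) d tX).
Qed.

Lemma pushforward_snd_tangent p X : tangent A p X ->
  tangent A2 p.2 (Defs.pushforward A2 snd p X).
Proof.
move=> tX; have [u [v [A1u A2v d]]] := prod_cover p.
exact: (pushforward_tangent hA (prod_atlas_chart A1u A2v) A2v (@snd_dom u v)
  (snd_cmap u v) (snd_cinv u v) d tX).
Qed.

Lemma pushforward_fst_chart u v p (a : 'rV[R]_(n1 + n2)) : A1 u -> A2 v ->
  dom (prod_chart u v) p ->
  Defs.pushforward A1 fst p (chart_tvec A (prod_chart u v) p a) =
  chart_tvec A1 u p.1 (lsubmx a).
Proof.
move=> A1u A2v d.
rewrite (pushforward_chart_tvec hA (prod_atlas_chart A1u A2v) A1u
  (@fst_dom u v) (fst_cmap u v) (fst_cinv u v) a d).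
by congr chart_tvec; apply/rowP => j; rewrite !mxE.
Qed.

Lemma pushforward_snd_chart u v p (a : 'rV[R]_(n1 + n2)) : A1 u -> A2 v ->
  dom (prod_chart u v) p ->
  Defs.pushforward A2 snd p (chart_tvec A (prod_chart u v) p a) =
  chart_tvec A2 v p.2 (rsubmx a).
Proof.
move=> A1u A2v d.
rewrite (pushforward_chart_tvec hA (prod_atlas_chart A1u A2v) A2v
  (@snd_dom u v) (snd_cmap u v) (snd_cinv u v) a d).
by congr chart_tvec; apply/rowP => j; rewrite !mxE.
Qed.

Lemma pullback_fst_smooth g p (X Y : vfield R (M1 * M2)%type) :
  riemannian_metric A1 g -> smooth_field_at A p X -> smooth_field_at A p Y ->
  smooth_at A p (fun q => pullback A1 fst g q (X q) (Y q)).
Proof.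
move=> hg sX sY; have [u [v [A1u A2v d]]] := prod_cover p.
exact: (pullback_smooth hA hA1 (prod_atlas_chart A1u A2v) A1u (@fst_dom u v)
  (fst_cmap u v) (fst_cinv u v) d hg sX sY).
Qed.

Lemma pullback_snd_smooth g p (X Y : vfield R (M1 * M2)%type) :
  riemannian_metric A2 g -> smooth_field_at A p X -> smooth_field_at A p Y ->
  smooth_at A p (fun q => pullback A2 snd g q (X q) (Y q)).
Proof.
move=> hg sX sY; have [u [v [A1u A2v d]]] := prod_cover p.
exact: (pullback_smooth hA hA2 (prod_atlas_chart A1u A2v) A2v (@snd_dom u v)
  (snd_cmap u v) (snd_cinv u v) d hg sX sY).
Qed.

Lemma hliftE p X phi : smooth_at A1 p.1 phi ->
  X (hlift phi) = Defs.pushforward A1 fst p X phi.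
Proof. by move=> s; rewrite /Defs.pushforward (asboolT s). Qed.

Lemma vliftE p X phi : smooth_at A2 p.2 phi ->
  X (vlift phi) = Defs.pushforward A2 snd p X phi.
Proof. by move=> s; rewrite /Defs.pushforward (asboolT s). Qed.

Lemma pushforward_lin (N : topologicalType) k (B : set (chart R N k))
    (F : M1 * M2 -> N) p (a : R) X Y :
  Defs.pushforward B F p (fun phi => a * X phi + Y phi) =
  fun phi => a * Defs.pushforward B F p X phi + Defs.pushforward B F p Y phi.
Proof.
rewrite funeqE => phi; rewrite /Defs.pushforward; case: asboolP => // _.
by rewrite mulr0 addr0.
Qed.

Section WarpedMetric.
Variables (g1 : tensor2 R M1) (g2 : tensor2 R M2).
Hypotheses (hg1 : riemannian_metric A1 g1) (hg2 : riemannian_metric A2 g2).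
Variables (c : R) (f1 : M1 -> R) (f2 : M2 -> R).
Hypotheses (hf1 : smooth A1 f1) (hf2 : smooth A2 f2) (f1_gt0 : forall x, 0 < f1 x).
Let h := warped_metric A1 A2 c f1 f2 g1 g2.

(** The factor 1/2 is absorbed by the two equal summands of [odot]. *)
Lemma warped_metricE p X Y : h p X Y =
  g1 p.1 (Defs.pushforward A1 fst p X) (Defs.pushforward A1 fst p Y)
  + f1 p.1 ^+ 2 * g2 p.2 (Defs.pushforward A2 snd p X) (Defs.pushforward A2 snd p Y)
  + (c * f2 p.2) ^+ 2 * (X (hlift f1) * Y (hlift f1)).
Proof.
rewrite /h /warped_metric /pullback /odot /differential /hlift /vlift /=.
by congr (_ + _); field.
Qed.

Lemma warped_metric_riemannian : riemannian_metric A h.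
Proof.
split.
- move=> p X Y tX tY; rewrite !warped_metricE.
  rewrite (Defs.metric_sym hg1 (pushforward_fst_tangent tX) (pushforward_fst_tangent tY)).
  rewrite (Defs.metric_sym hg2 (pushforward_snd_tangent tX) (pushforward_snd_tangent tY)).
  by rewrite [X _ * _]mulrC.
- move=> p a X Y Z tX tY tZ; rewrite !warped_metricE !pushforward_lin.
  rewrite (metric_linear hg1 a (pushforward_fst_tangent tX)
    (pushforward_fst_tangent tY) (pushforward_fst_tangent tZ)).
  rewrite (metric_linear hg2 a (pushforward_snd_tangent tX)
    (pushforward_snd_tangent tY) (pushforward_snd_tangent tZ)).
  by ring.
- move=> p X tX X0; rewrite warped_metricE.
  have t1 := pushforward_fst_tangent tX; have t2 := pushforward_snd_tangent tX.
  have g1X := metric_ge0 hA1 hg1 t1; have g2X := metric_ge0 hA2 hg2 t2.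
  have fp : 0 < f1 p.1 ^+ 2 by rewrite exprn_gt0.
  (* The term in the differential of [f1] is only nonnegative, so strict positivity has to come from
     one of the two pullbacks. *)
  apply: ltr_wpDr; first by rewrite mulr_ge0// ?sqr_ge0// -expr2 sqr_ge0.
  case: (pselect (Defs.pushforward A1 fst p X = fun=> 0)) => [e1|n1X]; last first.
    apply: ltr_pwDl; first exact: (metric_pos hg1).
    by rewrite mulr_ge0// ltW.
  case: (pselect (Defs.pushforward A2 snd p X = fun=> 0)) => [e2|n2X]; last first.
    apply: ltr_wpDl => //; rewrite mulr_gt0//.
    exact: (metric_pos hg2).
  (* If both pushforwards vanish, [X] kills every coordinate function of a product chart. *)
  exfalso; apply: X0.
  have [u [v [A1u A2v d]]] := prod_cover p.
  have Aw := prod_atlas_chart A1u A2v.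
  apply: (tangent_inj hA Aw d tX (tangent0 hA p)) => i.
  case: (split_ordP i) => k ->.
    have -> : xcoord (prod_chart u v) (lshift n2 k) = hlift (xcoord u k).
      by rewrite funeqE => q; rewrite /xcoord/= row_mxEl.
    rewrite (@hliftE p) ?e1//.
    by apply: (smooth_at_xcoord hA1) => //; case: d.
  have -> : xcoord (prod_chart u v) (rshift n1 k) = vlift (xcoord v k).
    by rewrite funeqE => q; rewrite /xcoord/= row_mxEr.
  rewrite (@vliftE p) ?e2//.
  by apply: (smooth_at_xcoord hA2) => //; case: d.
- move=> p X Y sX sY.
  have sf1 : smooth_at A p (hlift f1) by apply: smooth_at_hlift; exact: hf1.
  have sf2 : smooth_at A p (vlift f2) by apply: smooth_at_vlift; exact: hf2.
  under eq_fun do rewrite warped_metricE.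
  apply: smooth_atD; first apply: smooth_atD.
  + exact: pullback_fst_smooth.
  + apply: smooth_atM; last exact: pullback_snd_smooth.
    exact: smooth_atX sf1.
  + apply: smooth_atM.
      apply: smooth_atX; apply: smooth_atM; first exact: smooth_at_cst.
      exact: sf2.
    by apply: smooth_atM; exact: smooth_field_apply.
Qed.

End WarpedMetric.

End ProductTangent.

(** * The Laplacian of the warped metric *)

Section RankOneUpdate.
Context {R : realType} {n : nat}.
Variables (G : 'M[R]_n) (F : 'rV[R]_n) (s : R).
Hypotheses (Gu : G \in unitmx) (GT : G^T = G).
Let W := F *m invmx G.
Let b := (W *m F^T) 0 0.
Hypothesis sb0 : 1 + s * b != 0.
Let K := invmx G - (s / (1 + s * b)) *: (W^T *m W).

Let GWT : G *m W^T = F^T.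
Proof. by rewrite /W trmx_mul trmx_inv GT mulmxA mulmxV// mul1mx. Qed.

Let WFT : W *m F^T = b%:M.
Proof. by rewrite [LHS]mx11_scalar. Qed.

Let FWT : F *m W^T = b%:M.
Proof. by rewrite -[LHS]trmxK trmx_mul trmxK WFT tr_scalar_mx. Qed.

(** As [F *m W^T] is the scalar [b], the multiples of [F^T *m W] add up to s - (s / (1 + s b)) (1 +
    s b) = 0. *)
Let update_mul : (G + s *: (F^T *m F)) *m K = 1%:M.
Proof.
rewrite /K mulmxBr mulmxDl mulmxV// -!scalemxAr mulmxDl (mulmxA G) GWT.
have -> : s *: (F^T *m F) *m (W^T *m W) = (s * b) *: (F^T *m W).
  by rewrite -scalemxAl -mulmxA (mulmxA F) FWT mul_scalar_mx -scalemxAr scalerA.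
rewrite -scalemxAl -(mulmxA F^T) -/W -[X in _ *: (X + _)]scale1r -scalerDl scalerA.
by rewrite divfK// addrK.
Qed.

Lemma rank_one_update_unit : G + s *: (F^T *m F) \in unitmx.
Proof. by case: (mulmx1_unit update_mul). Qed.

Lemma rank_one_update_inv : invmx (G + s *: (F^T *m F)) = K.
Proof.
by rewrite -[RHS](mulKmx rank_one_update_unit) update_mul mulmx1.
Qed.

Let KFT : invmx (G + s *: (F^T *m F)) *m F^T = (1 + s * b)^-1 *: W^T.
Proof.
rewrite rank_one_update_inv /K mulmxBl -scalemxAl -(mulmxA W^T) WFT.
have -> : invmx G *m F^T = W^T by rewrite -GWT mulKmx.
rewrite mul_mx_scalar scalerA -{1}[W^T]scale1r -scalerBl; congr (_ *: _).
by field.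
Qed.

(** The updated inverse sends [F^T] to [W^T] divided by 1 + s b, and cyclicity reduces the trace of
    a column times a row to a scalar. *)
Lemma rank_one_update_trace (d : 'rV[R]_n) :
  \tr (invmx (G + s *: (F^T *m F)) *m (F^T *m d)) = (d *m W^T) 0 0 / (1 + s * b).
Proof.
rewrite mulmxA KFT -scalemxAl linearZ/= mxtrace_mulC.
by rewrite [X in \tr X]mx11_scalar mxtrace_scalar mulr1n mulrC.
Qed.

Lemma rank_one_update_trace_self :
  \tr (invmx (G + s *: (F^T *m F)) *m (F^T *m F)) = b / (1 + s * b).
Proof. by rewrite rank_one_update_trace FWT mxE eqxx mulr1n. Qed.

(* The derivative of log det (G + s F^T F) = log det G + log (1 + s b), where D
   and d stand for the derivatives of G and F. *)
Lemma rank_one_update_dlogdet (D : 'M[R]_n) (d : 'rV[R]_n) :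
  \tr (invmx (G + s *: (F^T *m F)) *m (D + s *: (d^T *m F + F^T *m d))) =
  \tr (invmx G *m D) +
  s * (2 * (d *m W^T) 0 0 - (W *m D *m W^T) 0 0) / (1 + s * b).
Proof.
rewrite mulmxDr raddfD/= -scalemxAr linearZ/= mulmxDr raddfD/=.
rewrite (rank_one_update_trace d).
have -> : \tr (invmx (G + s *: (F^T *m F)) *m (d^T *m F)) =
    \tr (invmx (G + s *: (F^T *m F)) *m (F^T *m d)).
  rewrite -mxtrace_tr !trmx_mul trmxK trmx_inv raddfD/= GT linearZ/=.
  by rewrite trmx_mul trmxK mxtrace_mulC.
rewrite (rank_one_update_trace d).
rewrite {1}rank_one_update_inv /K mulmxBl raddfB/= -scalemxAl linearZ/=.
have -> : \tr (W^T *m W *m D) = (W *m D *m W^T) 0 0.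
  rewrite -mulmxA mxtrace_mulC.
  by rewrite [X in \tr X]mx11_scalar mxtrace_scalar mulr1n.
by field.
Qed.

End RankOneUpdate.

(** * Derivatives along the two factors of a product *)

Section Slices.
Context {R : realType} {M1 M2 : topologicalType} {n1 n2 : nat}.
Variables (A1 : set (chart R M1 n1)) (A2 : set (chart R M2 n2)).
Hypotheses (hA1 : smooth_atlas A1) (hA2 : smooth_atlas A2).
Variables (u : chart R M1 n1) (v : chart R M2 n2).
Hypotheses (A1u : A1 u) (A2v : A2 v).
Variables (x : M1) (y : M2).
Hypotheses (ux : dom u x) (vy : dom v y).
Let A := prod_atlas A1 A2.
Let w := prod_chart u v.
Implicit Types psi : M1 * M2 -> R.

Let hA : smooth_atlas A. Proof. exact: prod_smooth_atlas. Qed.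
Let Aw : A w. Proof. exact: prod_atlas_chart. Qed.
Let wp : dom w (x, y). Proof. by []. Qed.

Let hslice_cinv psi : (fun q => psi (q, y)) \o cinv u =
  (psi \o cinv w) \o (fun z => row_mx z (cmap v y)).
Proof.
rewrite funeqE => z /=; rewrite row_mxKl row_mxKr.
by rewrite (chart_cancel (atlas_chart hA2 A2v) vy).
Qed.

Let vslice_cinv psi : (fun q => psi (x, q)) \o cinv v =
  (psi \o cinv w) \o (fun z => row_mx (cmap u x) z).
Proof.
rewrite funeqE => z /=; rewrite row_mxKl row_mxKr.
by rewrite (chart_cancel (atlas_chart hA1 A1u) ux).
Qed.

Let hrow_coord j (z : 'rV[R]_n2) : (fun z' : 'rV[R]_n1 => (row_mx z' z) 0 j) =
  match fintype.split j with inl k => fun z' => z' 0 k | inr k => fun=> z 0 k end.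
Proof.
by rewrite funeqE => z'; rewrite mxE; case: fintype.split.
Qed.

Let vrow_coord j (z : 'rV[R]_n1) : (fun z' : 'rV[R]_n2 => (row_mx z z') 0 j) =
  match fintype.split j with inl k => fun=> z 0 k | inr k => fun z' => z' 0 k end.
Proof.
by rewrite funeqE => z'; rewrite mxE; case: fintype.split.
Qed.

Lemma smooth_at_hslice psi : smooth_at A (x, y) psi ->
  smooth_at A1 x (fun q => psi (q, y)).
Proof.
move=> s; apply/(smooth_at_chart hA1 _ A1u ux); rewrite hslice_cinv.
apply: smooth_near_comp; last exact: s Aw wp.
move=> j; rewrite hrow_coord; case: fintype.split => k.
  exact: smooth_near_coord.
exact: smooth_near_cst.
Qed.

Lemma smooth_at_vslice psi : smooth_at A (x, y) psi ->
  smooth_at A2 y (fun q => psi (x, q)).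
Proof.
move=> s; apply/(smooth_at_chart hA2 _ A2v vy); rewrite vslice_cinv.
apply: smooth_near_comp; last exact: s Aw wp.
move=> j; rewrite vrow_coord; case: fintype.split => k.
  exact: smooth_near_cst.
exact: smooth_near_coord.
Qed.

(** In the product chart the slice at height [y] is an affine map whose derivative sends [a] to
    [row_mx a 0], so this is the chain rule. *)
Lemma horizontal_slice (a : 'rV[R]_n1) psi : smooth_at A (x, y) psi ->
  chart_tvec A w (x, y) (row_mx a 0) psi = chart_tvec A1 u x a (fun q => psi (q, y)).
Proof.
move=> s; rewrite (chart_tvecE w _ s).
rewrite (chart_tvecE _ _ (smooth_at_hslice s)) hslice_cinv.
have dpsi := smooth_near_differentiable (s w Aw wp).
rewrite (derive_row_sum _ dpsi) derive_comp_row//.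
  apply: eq_bigr => j _; congr (_ * _); rewrite hrow_coord mxE.
  case: fintype.split => k; first by rewrite derive_coord.
  by rewrite mxE derive_cst.
move=> j; rewrite hrow_coord; case: fintype.split => k.
  exact: differentiable_coord.
exact: differentiable_cst.
Qed.

Lemma vertical_slice (a : 'rV[R]_n2) psi : smooth_at A (x, y) psi ->
  chart_tvec A w (x, y) (row_mx 0 a) psi = chart_tvec A2 v y a (fun q => psi (x, q)).
Proof.
move=> s; rewrite (chart_tvecE w _ s).
rewrite (chart_tvecE _ _ (smooth_at_vslice s)) vslice_cinv.
have dpsi := smooth_near_differentiable (s w Aw wp).
rewrite (derive_row_sum _ dpsi) derive_comp_row//.
  apply: eq_bigr => j _; congr (_ * _); rewrite vrow_coord mxE.
  case: fintype.split => k; last by rewrite derive_coord.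
  by rewrite mxE derive_cst.
move=> j; rewrite vrow_coord; case: fintype.split => k.
  exact: differentiable_cst.
exact: differentiable_coord.
Qed.

Lemma frame_lshift i psi : smooth_at A (x, y) psi ->
  frame A w (lshift n2 i) (x, y) psi = frame A1 u i x (fun q => psi (q, y)).
Proof.
move=> s; rewrite /frame -(horizontal_slice _ s); congr chart_tvec.
apply/rowP => j; case: (split_ordP j) => k ->; rewrite ?row_mxEl ?row_mxEr !mxE.
  by rewrite eq_lshift.
by rewrite eq_rlshift andbF.
Qed.

Lemma frame_rshift i psi : smooth_at A (x, y) psi ->
  frame A w (rshift n1 i) (x, y) psi = frame A2 v i y (fun q => psi (x, q)).
Proof.
move=> s; rewrite /frame -(vertical_slice _ s); congr chart_tvec.
apply/rowP => j; case: (split_ordP j) => k ->; rewrite ?row_mxEl ?row_mxEr !mxE.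
  by rewrite eq_lrshift andbF.
by rewrite eq_rshift.
Qed.

End Slices.

Lemma smooth_manifold_atlas (R : realType) (M : topologicalType) n
  (A : set (chart R M n)) : smooth_manifold A -> smooth_atlas A.
Proof. by case=> _ _ *; split. Qed.

Section DerivationBlocks.
Context {R : realType} {M : topologicalType} {n : nat}.
Variable A : set (chart R M n).
Hypothesis hA : smooth_atlas A.

Lemma chart_tvec0 u p : A u -> dom u p -> chart_tvec A u p 0 = fun=> 0.
Proof.
move=> Au up; rewrite funeqE => phi; rewrite chart_tvec_sum// big1// => i _.
by rewrite mxE mul0r.
Qed.

Lemma dmx_near p X k l (B C : M -> 'M[R]_(k, l)) : tangent A p X ->
  (\forall q \near p, B q = C q) -> dmx X B = dmx X C.
Proof.
move=> tX e; apply/matrixP => i j; rewrite !mxE; apply: (tangent_near hA tX).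
by apply: filterS e => q ->.
Qed.

Lemma dmxD p X k l (B C : M -> 'M[R]_(k, l)) : tangent A p X ->
  (forall i j, smooth_at A p (fun q => B q i j)) ->
  (forall i j, smooth_at A p (fun q => C q i j)) ->
  dmx X (fun q => B q + C q) = dmx X B + dmx X C.
Proof.
move=> tX sB sC; apply/matrixP => i j; rewrite !mxE -(tangentD tX (sB i j) (sC i j)).
by congr X; rewrite funeqE => q; rewrite mxE.
Qed.

Lemma dmxZ p X (s : R) k l (B : M -> 'M[R]_(k, l)) : tangent A p X ->
  (forall i j, smooth_at A p (fun q => B q i j)) ->
  dmx X (fun q => s *: B q) = s *: dmx X B.
Proof.
move=> tX sB; apply/matrixP => i j; rewrite !mxE -(tangentZ hA s tX (sB i j)).
by congr X; rewrite funeqE => q; rewrite mxE.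
Qed.

Lemma dmxZl p X (s : M -> R) k l (B : 'M[R]_(k, l)) : tangent A p X ->
  smooth_at A p s -> dmx X (fun q => s q *: B) = X s *: B.
Proof.
move=> tX ss; apply/matrixP => i j; rewrite !mxE mulrC -(tangentZ hA _ tX ss).
by congr X; rewrite funeqE => q; rewrite mxE mulrC.
Qed.

Lemma dmx_tr X k l (B : M -> 'M[R]_(k, l)) :
  dmx X (fun q => (B q)^T) = (dmx X B)^T.
Proof.
apply/matrixP => i j; rewrite !mxE.
by congr X; rewrite funeqE => q; rewrite mxE.
Qed.

Lemma dmx_block_diag p X k l (B : M -> 'M[R]_k) (C : M -> 'M[R]_l) :
  tangent A p X ->
  dmx X (fun q => block_mx (B q) 0 0 (C q)) = block_mx (dmx X B) 0 0 (dmx X C).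
Proof.
move=> tX; apply/matrixP => i j; rewrite mxE.
case: (split_ordP i) => i' ->; case: (split_ordP j) => j' ->.
- rewrite block_mxEul mxE; congr X.
  by rewrite funeqE => q; rewrite block_mxEul.
- rewrite block_mxEur mxE -[RHS](tangent_cst 0 tX); congr X.
  by rewrite funeqE => q; rewrite block_mxEur mxE.
- rewrite block_mxEdl mxE -[RHS](tangent_cst 0 tX); congr X.
  by rewrite funeqE => q; rewrite block_mxEdl mxE.
- rewrite block_mxEdr mxE; congr X.
  by rewrite funeqE => q; rewrite block_mxEdr.
Qed.

End DerivationBlocks.

(** * Derivative of the squared norm of a gradient *)

Section GradNorm.
Context {R : realType} {M : topologicalType} {n : nat}.
Variables (A : set (chart R M n)) (g : tensor2 R M).
Hypotheses (hA : smooth_atlas A) (hg : riemannian_metric A g).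
Variables (u : chart R M n) (p : M) (f : M -> R).
Hypotheses (Au : A u) (up : dom u p) (sf : smooth_at A p f).
Let F q : 'rV[R]_n := \row_i frame A u i q f.
Let G := gram A g u.
Let W q := F q *m invmx (G q).

Lemma grad_apply phi :
  ((\row_i frame A u i p phi) *m (W p)^T) 0 0 = grad A g f p phi.
Proof.
rewrite /W -(tcoord_grad hA hg f Au up) mxE.
rewrite (tangent_sum_frame hA phi Au up (grad_tangent hA hg p f)).
by apply: eq_bigr => i _; rewrite !mxE mulrC.
Qed.

Lemma grad_norm_coord : (W p *m (F p)^T) 0 0 = grad A g f p f.
Proof.
by rewrite -[W p *m _]trmxK mxE trmx_mul trmxK grad_apply.
Qed.

Lemma row_frame_smooth i j : smooth_at A p (fun q => F q i j).
Proof.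
apply: (smooth_at_ext hA _ (smooth_at_frame hA j Au up sf)).
by near=> q; rewrite mxE.
Unshelve. all: by end_near. Qed.

(** Differentiating F = W G gives X(W) G = X(F) - W X(G). Inserted in the product rule for |grad
    f|^2 = W F^T, with F^T = G W^T, this avoids differentiating the inverse Gram matrix. The result
    is the bracket in [rank_one_update_dlogdet]. *)
Lemma derive_grad_norm X : tangent A p X ->
  X (fun q => grad A g f q f) =
  2 * (dmx X F *m (W p)^T) 0 0 - (W p *m dmx X G *m (W p)^T) 0 0.
Proof.
move=> tX; have dn := near_dom (atlas_chart hA Au) up.
have sF := row_frame_smooth.
have sG i j := gram_smooth hA hg i j Au up.
have sW i j : smooth_at A p (fun q => W q i j).
  by apply: smooth_at_mulmx => // k l; exact: gram_inv_smooth.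
have dF : dmx X F = dmx X W *m G p + W p *m dmx X G.
  rewrite -(dmx_mul hA tX sW sG); apply: (dmx_near hA tX).
  by apply: filterS dn => q uq; rewrite /W mulmxKV//; exact: (gram_unit hA hg).
have FWG : F p = W p *m G p by rewrite /W mulmxKV//; exact: (gram_unit hA hg).
transitivity (dmx X (fun q => W q *m (F q)^T) 0 0).
  rewrite mxE; apply: (tangent_near hA tX).
  apply: filterS dn => q uq; rewrite -[W q *m _]trmxK mxE trmx_mul trmxK mxE.
  rewrite /W -(tcoord_grad hA hg f Au uq).
  rewrite {1}(tangent_sum_frame hA f Au uq (grad_tangent hA hg q f)).
  by apply: eq_bigr => i _; rewrite !mxE mulrC.
rewrite (dmx_mul hA tX sW); last by move=> i j; under eq_fun do rewrite mxE; exact: sF.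
rewrite dmx_tr FWG trmx_mul (gram_tr hg Au up) mulmxA.
have -> : dmx X W *m G p = dmx X F - W p *m dmx X G by rewrite dF addrK.
rewrite mulmxBl.
have -> : W p *m (dmx X F)^T = (dmx X F *m (W p)^T)^T by rewrite trmx_mul trmxK.
move: (dmx X F *m (W p)^T) (W p *m dmx X G *m (W p)^T) => B C.
by rewrite !mxE; ring.
Qed.

End GradNorm.

Section WarpedLaplacian.
Context {R : realType} {M1 M2 : topologicalType} {n1 n2 : nat}.
Variables (A1 : set (chart R M1 n1)) (A2 : set (chart R M2 n2)).
Hypotheses (hA1 : smooth_atlas A1) (hA2 : smooth_atlas A2).
Variables (g1 : tensor2 R M1) (g2 : tensor2 R M2).
Hypotheses (hg1 : riemannian_metric A1 g1) (hg2 : riemannian_metric A2 g2).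
Variables (c : R) (f1 : M1 -> R) (f2 : M2 -> R).
Hypotheses (hf1 : smooth A1 f1) (hf2 : smooth A2 f2) (f1_gt0 : forall x, 0 < f1 x).
Let A := prod_atlas A1 A2.
Let h := warped_metric A1 A2 c f1 f2 g1 g2.
Let b := fun x => grad A1 g1 f1 x f1.
Let s := fun y => (c * f2 y) ^+ 2.

Let hA : smooth_atlas A. Proof. exact: prod_smooth_atlas. Qed.
Let hh : riemannian_metric A h. Proof. exact: warped_metric_riemannian. Qed.

(** [s] is a square and [b] a squared length, so the Sherman-Morrison denominator never vanishes. *)
Let w_gt0 x y : 0 < 1 + s y * b x.
Proof.
by rewrite ltr_pwDl// mulr_ge0// ?sqr_ge0//; exact: (grad_self_ge0 hA1 hg1).
Qed.

Let w_neq0 x y : 1 + s y * b x != 0. Proof. by rewrite gt_eqF. Qed.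

Let f1_neq0 x : f1 x != 0. Proof. by rewrite gt_eqF. Qed.

Section InChart.
Variables (u : chart R M1 n1) (v : chart R M2 n2).
Hypotheses (A1u : A1 u) (A2v : A2 v).
Let w := prod_chart u v.
Let F q : 'rV[R]_n1 := \row_i frame A1 u i q f1.
Let G1 := gram A1 g1 u.
Let G2 := gram A2 g2 v.
Let W q := F q *m invmx (G1 q).

Let Aw : A w. Proof. exact: prod_atlas_chart. Qed.

Let push_fst_l i q : dom w q ->
  Defs.pushforward A1 fst q (frame A w (lshift n2 i) q) = frame A1 u i q.1.
Proof.
move=> wq; rewrite /frame (pushforward_fst_chart hA1 hA2 _ A1u A2v wq).
by congr chart_tvec; apply/rowP => j; rewrite !mxE eq_lshift.
Qed.

Let push_fst_r i q : dom w q ->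
  Defs.pushforward A1 fst q (frame A w (rshift n1 i) q) = fun=> 0.
Proof.
move=> wq; rewrite /frame (pushforward_fst_chart hA1 hA2 _ A1u A2v wq).
rewrite (_ : lsubmx _ = 0); first by apply: chart_tvec0 => //; case: wq.
by apply/rowP => j; rewrite !mxE eq_lrshift andbF.
Qed.

Let push_snd_l i q : dom w q ->
  Defs.pushforward A2 snd q (frame A w (lshift n2 i) q) = fun=> 0.
Proof.
move=> wq; rewrite /frame (pushforward_snd_chart hA1 hA2 _ A1u A2v wq).
rewrite (_ : rsubmx _ = 0); first by apply: chart_tvec0 => //; case: wq.
by apply/rowP => j; rewrite !mxE eq_rlshift andbF.
Qed.

Let push_snd_r i q : dom w q ->
  Defs.pushforward A2 snd q (frame A w (rshift n1 i) q) = frame A2 v i q.2.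
Proof.
move=> wq; rewrite /frame (pushforward_snd_chart hA1 hA2 _ A1u A2v wq).
by congr chart_tvec; apply/rowP => j; rewrite !mxE eq_rshift.
Qed.

(** A coordinate vector of one factor is killed by the pushforward to the other, hence the zero
    blocks; the lift of [f1] varies only along the first factor, so the rank-one term stays in the
    first block. *)
Let gram_warped q : dom w q -> gram A h w q =
  block_mx (G1 q.1 + s q.2 *: ((F q.1)^T *m F q.1)) 0 0 (f1 q.1 ^+ 2 *: G2 q.2).
Proof.
move=> wq; have [uq vq] := wq.
have z1 := metric0l hA1 hg1; have z2 := metric0l hA2 hg2.
have t1 i : tangent A1 q.1 (frame A1 u i q.1) by exact: frame_tangent.
have t2 i : tangent A2 q.2 (frame A2 v i q.2) by exact: frame_tangent.
have z1r i : g1 q.1 (frame A1 u i q.1) (fun=> 0) = 0.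
  by rewrite (Defs.metric_sym hg1 (t1 i) (tangent0 hA1 q.1)) z1.
have sf1 : smooth_at A1 q.1 f1 by exact: hf1.
apply/matrixP => i j; rewrite mxE /h warped_metricE.
rewrite !(hliftE _ sf1).
case: (split_ordP i) => i' ->; case: (split_ordP j) => j' ->.
- rewrite block_mxEul !push_fst_l// !push_snd_l// (z2 _ _ (tangent0 hA2 q.2)).
  by rewrite !mxE big_ord1 !mxE mulr0 addr0.
- rewrite block_mxEur push_fst_l// push_fst_r// push_snd_l// push_snd_r//.
  by rewrite z1r (z2 _ _ (t2 j')) !mulr0 mxE !addr0.
- rewrite block_mxEdl push_fst_l// push_fst_r// push_snd_l// push_snd_r//.
  rewrite (Defs.metric_sym hg2 (t2 i') (tangent0 hA2 q.2)).
  by rewrite (z1 _ _ (t1 j')) (z2 _ _ (t2 i')) mul0r !mulr0 mxE !addr0.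
- rewrite block_mxEdr !push_fst_r// !push_snd_r// (z1 _ _ (tangent0 hA1 q.1)).
  by rewrite mul0r mulr0 addr0 add0r !mxE.
Qed.

Let bE q : dom u q -> (W q *m (F q)^T) 0 0 = b q.
Proof. by move=> uq; exact: (grad_norm_coord hA1 hg1 f1 A1u uq). Qed.

Let sb_neq0 q : dom w q -> 1 + s q.2 * (W q.1 *m (F q.1)^T) 0 0 != 0.
Proof. by move=> [uq _]; rewrite bE. Qed.

Let G1_unit q : dom u q -> G1 q \in unitmx.
Proof. exact: (gram_unit hA1 hg1). Qed.

Let G1_tr q : dom u q -> (G1 q)^T = G1 q.
Proof. exact: (gram_tr hg1). Qed.

Let inv_gram q : dom w q -> invmx (gram A h w q) =
  block_mx (invmx (G1 q.1 + s q.2 *: ((F q.1)^T *m F q.1))) 0 0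
           ((f1 q.1 ^+ 2)^-1 *: invmx (G2 q.2)).
Proof.
move=> wq; have := gram_unit hA hh Aw wq; rewrite gram_warped// => uH.
rewrite invmx_block_diag// invmxZ// unitmxZ ?unitfE ?sqrf_eq0//.
by apply: (gram_unit hA2 hg2) => //; case: wq.
Qed.

Lemma tcoord_grad_hlift phi q : smooth A1 phi -> dom w q ->
  tcoord w (grad A h (hlift phi) q) =
  row_mx (tcoord u (grad A1 g1 phi q.1) - (s q.2 * grad A1 g1 f1 q.1 phi
    / (1 + s q.2 * b q.1)) *: tcoord u (grad A1 g1 f1 q.1)) 0.
Proof.
move=> sphi wq; have [uq vq] := wq; rewrite (tcoord_grad hA hh)// inv_gram//.
have -> : \row_i frame A w i q (hlift phi) =
    row_mx (\row_i frame A1 u i q.1 phi) 0.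
  apply/rowP => i; rewrite mxE (hliftE _ (sphi q.1)).
  case: (split_ordP i) => i' ->; first by rewrite push_fst_l// row_mxEl mxE.
  by rewrite push_fst_r// row_mxEr mxE.
rewrite mul_row_block !mul0mx !mulmx0 !addr0; congr row_mx.
rewrite (rank_one_update_inv (G1_unit uq) (G1_tr uq) (sb_neq0 wq)).
(* The rank-one correction contracts the differential of [phi] with [W], and this scalar is the
   derivative of [phi] along grad f1. *)
have rowW : (\row_i frame A1 u i q.1 phi) *m ((W q.1)^T *m W q.1) =
    grad A1 g1 f1 q.1 phi *: W q.1.
  rewrite mulmxA [X in X *m _]mx11_scalar (grad_apply hA1 hg1 f1 A1u uq).
  exact: mul_scalar_mx.
rewrite mulmxBr -scalemxAr rowW scalerA (bE uq).
rewrite (tcoord_grad hA1 hg1 phi A1u uq) (tcoord_grad hA1 hg1 f1 A1u uq).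
by congr (_ - _ *: _); rewrite mulrAC.
Qed.

Lemma tcoord_grad_vlift phi q : smooth A2 phi -> dom w q ->
  tcoord w (grad A h (vlift phi) q) =
  row_mx 0 ((f1 q.1 ^+ 2)^-1 *: tcoord v (grad A2 g2 phi q.2)).
Proof.
move=> sphi wq; have [uq vq] := wq; rewrite (tcoord_grad hA hh)// inv_gram//.
have -> : \row_i frame A w i q (vlift phi) =
    row_mx 0 (\row_i frame A2 v i q.2 phi).
  apply/rowP => i; rewrite mxE (vliftE _ (sphi q.2)).
  case: (split_ordP i) => i' ->; last by rewrite push_snd_r// row_mxEr mxE.
  by rewrite push_snd_l// row_mxEl mxE.
rewrite mul_row_block !mul0mx !mulmx0 !add0r; congr row_mx.
by rewrite -scalemxAr (tcoord_grad hA2 hg2 phi A2v vq).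
Qed.

Variables (x : M1) (y : M2).
Hypotheses (ux : dom u x) (vy : dom v y).

Let wp : dom w (x, y). Proof. by []. Qed.

Let near_u : \forall q \near x, dom u q.
Proof. exact: near_dom (atlas_chart hA1 A1u) ux. Qed.

Let near_v : \forall q \near y, dom v q.
Proof. exact: near_dom (atlas_chart hA2 A2v) vy. Qed.

Let sgram i j : smooth_at A (x, y) (fun q => gram A h w q i j).
Proof. exact: (gram_smooth hA hh). Qed.

Let sF i j : smooth_at A1 x (fun q => F q i j).
Proof. exact: (row_frame_smooth hA1 A1u ux (@hf1 x)). Qed.

Let sG1 i j : smooth_at A1 x (fun q => G1 q i j).
Proof. exact: (gram_smooth hA1 hg1). Qed.

(** The first block is the log-determinant derivative of a rank-one update at fixed [y]. In the
    second block only the factor [f1 ^+ 2] varies; [G2] cancels with its inverse and the trace of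
    the identity gives [n2]. *)
Lemma trace_horizontal (a : 'rV[R]_n1) (X := chart_tvec A1 u x a) :
  \tr (invmx (gram A h w (x, y)) *m
    dmx (chart_tvec A w (x, y) (row_mx a 0)) (gram A h w)) =
  \tr (invmx (G1 x) *m dmx X G1) + s y * X b / (1 + s y * b x)
  + n2%:R * (2 * X f1 / f1 x).
Proof.
have tX : tangent A1 x X by exact: chart_tvec_tangent.
have -> : dmx (chart_tvec A w (x, y) (row_mx a 0)) (gram A h w) =
    dmx X (fun q => block_mx (G1 q + s y *: ((F q)^T *m F q)) 0 0
                             (f1 q ^+ 2 *: G2 y)).
  apply/matrixP => i j; rewrite !mxE.
  rewrite (horizontal_slice hA1 hA2 A1u A2v ux vy a (sgram i j)).
  apply: (tangent_near hA1 tX); apply: filterS near_u => q uq.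
  by rewrite gram_warped.
rewrite (dmx_block_diag _ _ tX) inv_gram// mulmx_block !mul0mx !mulmx0 !addr0 add0r.
rewrite mxtrace_block.
have sFT i j : smooth_at A1 x (fun q => (F q)^T i j).
  by under eq_fun do rewrite mxE; exact: sF.
have sFF := smooth_at_mulmx sFT sF.
rewrite (dmxD tX sG1); last first.
  move=> i j; under eq_fun do rewrite mxE.
  by apply: smooth_atM; [exact: smooth_at_cst|exact: sFF].
rewrite (dmxZ hA1 _ tX sFF) (dmx_mul hA1 tX sFT sF) dmx_tr.
rewrite (rank_one_update_dlogdet (G1_unit ux) (G1_tr ux) (sb_neq0 wp)).
rewrite -(derive_grad_norm hA1 hg1 A1u ux (@hf1 x) tX) (bE ux); congr (_ + _).
have sf12 : smooth_at A1 x (fun q => f1 q ^+ 2) by exact/smooth_atX/hf1.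
rewrite (dmxZl hA1 _ tX sf12) -scalemxAr -scalemxAl mulVmx; last first.
  exact: (gram_unit hA2 hg2).
rewrite !linearZ/= mxtrace1; under eq_fun do rewrite expr2.
rewrite (tangentM hA1 tX (@hf1 x) (@hf1 x)).
by field.
Qed.

(** Along the second factor [G1], [F] and [f1] are constant: the first block varies through [s]
    alone, and the scale of the second block cancels with its inverse. *)
Lemma trace_vertical (a : 'rV[R]_n2) (X := chart_tvec A2 v y a) :
  \tr (invmx (gram A h w (x, y)) *m
    dmx (chart_tvec A w (x, y) (row_mx 0 a)) (gram A h w)) =
  2 * c ^+ 2 * f2 y * X f2 * b x / (1 + s y * b x)
  + \tr (invmx (G2 y) *m dmx X G2).
Proof.
have tX : tangent A2 y X by exact: chart_tvec_tangent.
have -> : dmx (chart_tvec A w (x, y) (row_mx 0 a)) (gram A h w) =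
    dmx X (fun q => block_mx (G1 x + s q *: ((F x)^T *m F x)) 0 0
                             (f1 x ^+ 2 *: G2 q)).
  apply/matrixP => i j; rewrite !mxE.
  rewrite (vertical_slice hA1 hA2 A1u A2v ux vy a (sgram i j)).
  apply: (tangent_near hA2 tX); apply: filterS near_v => q vq.
  by rewrite gram_warped.
rewrite (dmx_block_diag _ _ tX) inv_gram// mulmx_block !mul0mx !mulmx0 !addr0 add0r.
rewrite mxtrace_block.
have ss : smooth_at A2 y s.
  by apply: smooth_atX; apply: smooth_atM; [exact: smooth_at_cst|exact: hf2].
have sG2 i j : smooth_at A2 y (fun q => G2 q i j) by exact: (gram_smooth hA2 hg2).
rewrite (dmxD tX); last 2 first.
- by move=> i j; exact: smooth_at_cst.
- move=> i j; under eq_fun do rewrite mxE.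
  by apply: smooth_atM; [exact: ss|exact: smooth_at_cst].
have -> : dmx X (fun=> G1 x) = 0.
  by apply/matrixP => i j; rewrite !mxE (tangent_cst _ tX).
rewrite add0r (dmxZl hA2 _ tX ss) -scalemxAr linearZ/=.
rewrite (rank_one_update_trace_self (G1_unit ux) (G1_tr ux) (sb_neq0 wp)) (bE ux).
rewrite (dmxZ hA2 _ tX sG2) -scalemxAr -scalemxAl !linearZ/=; congr (_ + _).
  have -> : X s = 2 * c ^+ 2 * f2 y * X f2.
    have -> : s = (fun q => c ^+ 2 * (f2 q * f2 q)).
      by rewrite funeqE => q; rewrite /s; ring.
    rewrite (tangentZ hA2 _ tX); last by apply: smooth_atM; exact: hf2.
    by rewrite (tangentM hA2 tX (@hf2 y) (@hf2 y)); ring.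
  by ring.
by rewrite mulrA mulfV ?mul1r// sqrf_eq0.
Qed.

End InChart.

(** Write W = grad f1, V = grad phi, a = W(phi) and k = s a / (1 + s b). The divergence of V - k W
    for [g1] is Delta phi - k Delta f1 - W(k), and half of the trace adds (V - k W)(s b) / (2 (1 + s
    b)). The terms in W(a) and V(b) form the Hessian of [phi]; those in W(b) leave s^2 a W(b) / (2
    (1 + s b)^2), where W(b) / 2 is the Hessian of [f1] on (W, W). The second block adds n2 (V - k
    W)(f1) / f1, and a - k b = a / (1 + s b). *)
Lemma laplacian_hlift phi x y : smooth A1 phi ->
  laplacian A h (hlift phi) (x, y) =
    laplacian A1 g1 phi x
    + n2%:R * grad A1 g1 f1 x phi / (f1 x * (1 + s y * b x))
    - s y / (1 + s y * b x)
      * (grad A1 g1 f1 x phi * laplacian A1 g1 f1 x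
         + hessian A1 g1 phi x (grad A1 g1 f1 x) (grad A1 g1 f1 x)
         - s y * grad A1 g1 f1 x phi / (1 + s y * b x)
           * hessian A1 g1 f1 x (grad A1 g1 f1 x) (grad A1 g1 f1 x)).
Proof.
move=> sphi; have [u A1u ux] := atlas_cover hA1 x.
have [v A2v vy] := atlas_cover hA2 y.
pose w := prod_chart u v.
have Aw : A w by exact: prod_atlas_chart.
have wp : dom w (x, y) by [].
have nw := near_dom (atlas_chart hA Aw) wp.
have nu := near_dom (atlas_chart hA1 A1u) ux.
have hL1 := levi_civita_connectionP hA1 hg1.
have hLh := levi_civita_connectionP hA hh.
have slift : smooth_at A (x, y) (hlift phi).
  by apply: (smooth_at_hlift hA1 hA2); exact: sphi.
have sgrad := grad_smooth hA hh slift.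
have sV := grad_smooth hA1 hg1 (sphi x); have tV := smooth_field_tangent sV.
have sW := grad_smooth hA1 hg1 (@hf1 x); have tW := smooth_field_tangent sW.
pose a q := grad A1 g1 f1 q phi.
(* The coefficient of grad f1 in the gradient of the lift; with [y] frozen it is a function on the
   first factor. *)
pose kappa q := s y * a q * (1 + s y * b q)^-1.
have sa : smooth_at A1 x a by exact: (smooth_field_apply sW (sphi x)).
have sb : smooth_at A1 x b by exact: (smooth_field_apply sW (@hf1 x)).
have ssa : smooth_at A1 x (fun q => s y * a q).
  by apply: smooth_atM => //; exact: smooth_at_cst.
have ssb : smooth_at A1 x (fun q => s y * b q).
  by apply: smooth_atM => //; exact: smooth_at_cst.
have sw : smooth_at A1 x (fun q => 1 + s y * b q).
  by apply: smooth_atD => //; exact: smooth_at_cst.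
have swV : smooth_at A1 x (fun q => (1 + s y * b q)^-1) by exact: (smooth_atV hA1).
have skappa : smooth_at A1 x kappa by exact: smooth_atM.
have sx i := smooth_at_xcoord hA1 i A1u ux.
have sVx i : smooth_at A1 x (fun q => grad A1 g1 phi q (xcoord u i)).
  exact: (smooth_field_apply sV).
have sWx i : smooth_at A1 x (fun q => grad A1 g1 f1 q (xcoord u i)).
  exact: (smooth_field_apply sW).
rewrite (laplacianE hA hh hLh Aw wp slift) big_split_ord/=.
(* The vertical components of the gradient vanish near the point, and so do their derivatives. *)
have -> : \sum_(j < n2) frame A w (rshift n1 j) (x, y)
    (fun q => grad A h (hlift phi) q (xcoord w (rshift n1 j))) = 0.
  rewrite big1// => j _; have tf := frame_tangent (rshift n1 j) Aw wp.
  rewrite -[RHS](tangent_cst 0 tf); apply: (tangent_near hA tf).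
  apply: filterS nw => q wq; have := tcoord_grad_hlift A1u A2v sphi wq.
  by move=> /rowP/(_ (rshift n1 j)); rewrite row_mxEr !mxE.
rewrite addr0.
(* The product rule on [kappa] times the components of grad f1; the derivatives of [kappa]
   reassemble into its derivative along grad f1. *)
have -> : \sum_(i < n1) frame A w (lshift n2 i) (x, y)
      (fun q => grad A h (hlift phi) q (xcoord w (lshift n2 i))) =
    \sum_i frame A1 u i x (fun q => grad A1 g1 phi q (xcoord u i))
    - kappa x * \sum_i frame A1 u i x (fun q => grad A1 g1 f1 q (xcoord u i))
    - grad A1 g1 f1 x kappa.
  rewrite (tangent_sum_frame hA1 kappa A1u ux tW) mulr_sumr -!sumrB.
  apply: eq_bigr => i _; have tf := frame_tangent i A1u ux.
  rewrite (frame_lshift hA1 hA2 A1u A2v ux vy); last first.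
    by apply: (smooth_field_apply sgrad); exact: smooth_at_xcoord.
  rewrite (@tangent_near _ _ _ _ hA1 _ _ _ (fun q =>
    grad A1 g1 phi q (xcoord u i) - kappa q * grad A1 g1 f1 q (xcoord u i)) tf).
    rewrite (tangentB hA1 tf (sVx i)); last exact: smooth_atM.
    rewrite (tangentM hA1 tf skappa (sWx i)).
    by ring.
  apply: filterS nu => q uq; have wq : dom w (q, y) by [].
  have := tcoord_grad_hlift A1u A2v sphi wq.
  by move=> /rowP/(_ (lshift n2 i)); rewrite row_mxEl !mxE.
have tg := grad_tangent hA hh (x, y) (hlift phi).
rewrite (tangent_chartE hA Aw wp tg) (tcoord_grad_hlift A1u A2v sphi wp)/=.
set V := (X in row_mx X 0).
rewrite -[X in \tr (_ *m X)]/(dmx (chart_tvec A w (x, y) (row_mx V 0)) (gram A h w)).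
rewrite (trace_horizontal A1u A2v ux vy).
have VE psi : chart_tvec A1 u x V psi =
    grad A1 g1 phi x psi - kappa x * grad A1 g1 f1 x psi.
  have -> : V = (- kappa x) *: tcoord u (grad A1 g1 f1 x) + tcoord u (grad A1 g1 phi x).
    by rewrite addrC scaleNr.
  rewrite chart_tvec_lin// -!(tangent_chartE hA1 A1u ux)//.
  by rewrite mulNr addrC.
have -> : dmx (chart_tvec A1 u x V) (gram A1 g1 u) =
    dmx (grad A1 g1 phi x) (gram A1 g1 u)
    - kappa x *: dmx (grad A1 g1 f1 x) (gram A1 g1 u).
  by apply/matrixP => i j; rewrite !mxE VE.
rewrite !VE mulmxBr -scalemxAr raddfB/= mxtraceZ.
rewrite (hessian_grad hA1 hg1 hL1 (sphi x) (@hf1 x)).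
rewrite (hessian_grad hA1 hg1 hL1 (@hf1 x) (@hf1 x)).
rewrite (laplacianE hA1 hg1 hL1 A1u ux (sphi x)).
rewrite (laplacianE hA1 hg1 hL1 A1u ux (@hf1 x)).
have -> : grad A1 g1 f1 x kappa =
    s y * grad A1 g1 f1 x a / (1 + s y * b x) -
    s y * a x * (s y * grad A1 g1 f1 x b) / (1 + s y * b x) ^+ 2.
  rewrite (tangentM hA1 tW ssa swV) (tangentZ hA1 _ tW sa).
  rewrite (tangentV hA1 tW sw (w_neq0 x y)).
  rewrite (tangentD tW (smooth_at_cst 1) ssb) (tangent_cst 1 tW).
  by rewrite (tangentZ hA1 _ tW sb) add0r; ring.
rewrite (grad_sym hA1 hg1 x phi f1) -!/(dmx _ _).
have := w_neq0 x y; have := f1_neq0 x.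
rewrite /kappa -/(b x) -/(a x) -/a -/b.
move: (grad A1 g1 f1 x a) (grad A1 g1 f1 x b) (grad A1 g1 phi x b) (a x) (b x) => *.
by field; apply/andP; split.
Qed.

(** The gradient is vertical with coefficient the inverse of [f1 ^+ 2], constant on the slice, so it
    factors out of both the divergence and the trace; the extra term is half of what [s] contributes
    in [trace_vertical]. *)
Lemma laplacian_vlift phi x y : smooth A2 phi ->
  laplacian A h (vlift phi) (x, y) =
    1 / f1 x ^+ 2
    * (laplacian A2 g2 phi y
       + c ^+ 2 * f2 y * b x * grad A2 g2 f2 y phi / (1 + s y * b x)).
Proof.
move=> sphi; have [u A1u ux] := atlas_cover hA1 x.
have [v A2v vy] := atlas_cover hA2 y.
pose w := prod_chart u v.
have Aw : A w by exact: prod_atlas_chart.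
have wp : dom w (x, y) by [].
have nw := near_dom (atlas_chart hA Aw) wp.
have nv := near_dom (atlas_chart hA2 A2v) vy.
have hL2 := levi_civita_connectionP hA2 hg2.
have hLh := levi_civita_connectionP hA hh.
have slift : smooth_at A (x, y) (vlift phi).
  by apply: (smooth_at_vlift hA1 hA2); exact: sphi.
have sgrad := grad_smooth hA hh slift.
have sV := grad_smooth hA2 hg2 (sphi y); have tV := smooth_field_tangent sV.
rewrite (laplacianE hA hh hLh Aw wp slift) big_split_ord/=.
rewrite [X in X + _ + _]big1 ?add0r; last first.
  move=> j _; have tf := frame_tangent (lshift n2 j) Aw wp.
  rewrite -[RHS](tangent_cst 0 tf); apply: (tangent_near hA tf).
  apply: filterS nw => q wq; have := tcoord_grad_vlift A1u A2v sphi wq.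
  by move=> /rowP/(_ (lshift n2 j)); rewrite row_mxEl !mxE.
have -> : \sum_(i < n2) frame A w (rshift n1 i) (x, y)
      (fun q => grad A h (vlift phi) q (xcoord w (rshift n1 i))) =
    (f1 x ^+ 2)^-1 *
    \sum_i frame A2 v i y (fun q => grad A2 g2 phi q (xcoord v i)).
  rewrite mulr_sumr; apply: eq_bigr => i _; have tf := frame_tangent i A2v vy.
  rewrite (frame_rshift hA1 hA2 A1u A2v ux vy); last first.
    by apply: (smooth_field_apply sgrad); exact: smooth_at_xcoord.
  rewrite -(tangentZ hA2 _ tf); last first.
    by apply: (smooth_field_apply sV); exact: smooth_at_xcoord.
  apply: (tangent_near hA2 tf).
  apply: filterS nv => q vq; have wq : dom w (x, q) by [].
  have := tcoord_grad_vlift A1u A2v sphi wq.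
  by move=> /rowP/(_ (rshift n1 i)); rewrite row_mxEr !mxE.
have tg := grad_tangent hA hh (x, y) (vlift phi).
rewrite (tangent_chartE hA Aw wp tg) (tcoord_grad_vlift A1u A2v sphi wp)/=.
set V := (X in row_mx 0 X).
rewrite -[X in \tr (_ *m X)]/(dmx (chart_tvec A w (x, y) (row_mx 0 V)) (gram A h w)).
rewrite (trace_vertical A1u A2v ux vy).
have VE psi : chart_tvec A2 v y V psi = (f1 x ^+ 2)^-1 * grad A2 g2 phi y psi.
  rewrite -[V]addr0 chart_tvec_lin// -(tangent_chartE hA2 A2v vy)//.
  by rewrite chart_tvec0// addr0.
have -> : dmx (chart_tvec A2 v y V) (gram A2 g2 v) =
    (f1 x ^+ 2)^-1 *: dmx (grad A2 g2 phi y) (gram A2 g2 v).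
  by apply/matrixP => i j; rewrite !mxE VE.
rewrite !VE -scalemxAr linearZ/= (laplacianE hA2 hg2 hL2 A2v vy (sphi y)).
rewrite (grad_sym hA2 hg2 y phi f2) -!/(dmx _ _).
have := w_neq0 x y; have := f1_neq0 x.
move: (grad A2 g2 f2 y phi) (b x) => *.
by field; apply/andP; split.
Qed.

End WarpedLaplacian.

Theorem theorem4p2 (R : realType) (m1 m2 : nat) (M1 M2 : topologicalType)
    (A1 : set (chart R M1 m1)) (A2 : set (chart R M2 m2))
    (hM1 : smooth_manifold A1) (hM2 : smooth_manifold A2)
    (g1 : tensor2 R M1) (g2 : tensor2 R M2)
    (hg1 : riemannian_metric A1 g1) (hg2 : riemannian_metric A2 g2)
    (c : R) (f1 : M1 -> R) (f2 : M2 -> R)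
    (hf1 : smooth A1 f1) (hf2 : smooth A2 f2)
    (f1_gt0 : forall x, 0 < f1 x) (f2_gt0 : forall y, 0 < f2 y)
    (phi1 : M1 -> R) (phi2 : M2 -> R)
    (hphi1 : smooth A1 phi1) (hphi2 : smooth A2 phi2) :
  let A := prod_atlas A1 A2 in
  let h := warped_metric A1 A2 c f1 f2 g1 g2 in
  let gradf1 := grad A1 g1 f1 in
  let gradf2 := grad A2 g2 f2 in
  let b1 := fun x => norm g1 x (gradf1 x) ^+ 2 in
  (forall (x : M1) (y : M2),
    laplacian A h (hlift phi1) (x, y) =
      laplacian A1 g1 phi1 x
      + m2%:R * gradf1 x phi1 / (f1 x * (1 + (c * f2 y) ^+ 2 * b1 x))
      - (c * f2 y) ^+ 2 / (1 + (c * f2 y) ^+ 2 * b1 x)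
        * (gradf1 x phi1 * laplacian A1 g1 f1 x
           + hessian A1 g1 phi1 x (gradf1 x) (gradf1 x)
           - (c * f2 y) ^+ 2 * gradf1 x phi1 / (1 + (c * f2 y) ^+ 2 * b1 x)
             * hessian A1 g1 f1 x (gradf1 x) (gradf1 x)))
  /\
  (forall (x : M1) (y : M2),
    laplacian A h (vlift phi2) (x, y) =
      1 / f1 x ^+ 2
      * (laplacian A2 g2 phi2 y
         + c ^+ 2 * f2 y * b1 x * gradf2 y phi2
           / (1 + (c * f2 y) ^+ 2 * b1 x))).
Proof.
have hA1 := smooth_manifold_atlas hM1; have hA2 := smooth_manifold_atlas hM2.
move=> A h gradf1 gradf2 b1; split=> x y; rewrite /b1 (norm_grad hA1 hg1).
  exact: laplacian_hlift.
exact: laplacian_vlift.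
Qed.
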